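(* Let $S=K[x_1,\dots,x_n]$ and let $U\subset S$ be a nonzero universal lex ideal. For any integer $c\ge0$ there exists a ladder set $N\subset U$ with $\#N=c$ such that for any ladder set $M\subset U$ with $\#M=c$ one has $m(N)\succeq m(M)$.
   Context: $K$ is a field, $S=K[x_1,\dots,x_n]$ is standard graded, and $>_{\mathrm{lex}}$ is the lexicographic order with $x_1>_{\mathrm{lex}}\cdots>_{\mathrm{lex}}x_n$. A monomial ideal $I$ is lex if $u\in I$ a monomial and $v>_{\mathrm{lex}}u$ a monomial of the same degree imply $v\in I$; a lex ideal $L\subset S$ is universal if $LS[x_{n+1}]$ is a lex ideal of $S[x_{n+1}]$. A nonzero universal lex ideal has the form $$U=(x_1^{a_1+1},\,x_1^{a_1}x_2^{a_2+1},\,\dots,\,x_1^{a_1}\cdots x_{t-1}^{a_{t-1}}x_t^{a_t+1}),\qquad 1\le t\le n,\ a_1,\dots,a_t\ge0,$$ or $U=S$ (in which case put $t=1$, $a_1=-1$). Put $\delta_i=x_1^{a_1}\cdots x_{i-1}^{a_{i-1}}x_i^{a_i+1}$ and $S^{(i)}=K[x_i,\dots,x_n]$. The set of monomials of $U$ is the disjoint union of the sets of monomials of $\delta_iS^{(i)}$, $i=1,\dots,t$. A set $N$ of monomials of $S^{(i)}$ is rev-lex if $u\in N$ and $v<_{\mathrm{lex}}u$ a monomial of $S^{(i)}$ of the same degree imply $v\in N$; it is a multicomplex if $u\in N$ and $v\mid u$ imply $v\in N$. A set of monomials $M\subset U$, written uniquely as $M=\biguplus_{i=1}^t\delta_iM_{\langle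 i\rangle}$ with $M_{\langle i\rangle}\subset S^{(i)}$, is a ladder set if (i) each $M_{\langle i\rangle}$ is a rev-lex multicomplex in $S^{(i)}$; and (ii) for $i=1,\dots,t-1$ and all $d$, if $\delta_iM_{\langle i\rangle}$ contains a monomial of degree $d$ then $\delta_{i+1}M_{\langle i+1\rangle}$ contains all monomials of degree $d$ in $\delta_{i+1}S^{(i+1)}$. For a monomial $u$, $\max u$ is the largest $\ell$ such that $x_\ell$ divides $u$, with $\max(1)=1$. For a finite set $M$ of monomials, $m_{\le i}(M)=\#\{u\in M:\max u\le i\}$ and $m(M)=(m_{\le1}(M),\dots,m_{\le n}(M))$. For $\mathbf a,\mathbf b\in\mathbb Z^n$, $\mathbf a\succeq\mathbf b$ means $a_i\ge b_i$ for all $i$. *)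

(* Defs.v *)
From HB Require Import structures.
From mathcomp Require Import all_boot all_order all_algebra.
From mathcomp Require Import finmap mpoly.

Set Implicit Arguments.
Unset Strict Implicit.
Unset Printing Implicit Defensive.

Import Order.TTheory GRing.Theory Num.Theory.
Local Open Scope ring_scope.

(* The variable x_l of the text, 1 <= l <= n, is 'X_i with i : 'I_n and
   i = l - 1; monomials are exponent vectors 'X_{1..n}, their product is
   written additively, and (v <= u)%MM is divisibility. *)

Section Ideals.
Variables (K : fieldType) (n : nat).
Implicit Types (I G : {mpoly K[n]} -> Prop) (A : 'X_{1..n} -> Prop).

(* Not ring_quotient.idealr_closed, which excludes the unit ideal. *)
Definition is_ideal I : Prop :=
  [/\ I 0, forall p q, I p -> I q -> I (p + q) & forall r p, I p -> I (r * p)].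

Definition ideal_gen G : {mpoly K[n]} -> Prop :=
  fun p => forall J : {mpoly K[n]} -> Prop,
    is_ideal J -> (forall g, G g -> J g) -> J p.

Definition ideal_gen_mon A : {mpoly K[n]} -> Prop :=
  ideal_gen (fun g => exists2 m, A m & g = 'X_[m]).

Definition nonzero_ideal I : Prop := exists2 p, I p & p != 0.

Definition monomial_ideal I : Prop :=
  exists A, forall p, I p <-> ideal_gen_mon A p.

End Ideals.

(* Lexicographic comparison of exponent vectors, first entry first, so that
   x_1 > ... > x_n. *)
Definition mlex_lt (n : nat) (u v : 'X_{1..n}) : bool :=
  ((u : seqlexi nat) < (v : seqlexi nat))%O.

Definition lex_ideal (K : fieldType) (n : nat) (I : {mpoly K[n]} -> Prop) : Prop :=
  monomial_ideal I /\
  forall u v : 'X_{1..n}, I 'X_[u] -> mdeg v = mdeg u -> mlex_lt u v -> I 'X_[v].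

(* The extension I S[x_{n+1}]. *)
Definition extend_ideal (K : fieldType) (n : nat) (I : {mpoly K[n]} -> Prop) :
  {mpoly K[n.+1]} -> Prop :=
  ideal_gen (fun g => exists2 p, I p & g = mwiden p).

Definition universal_lex_ideal (K : fieldType) (n : nat)
    (L : {mpoly K[n]} -> Prop) : Prop :=
  lex_ideal L /\ lex_ideal (extend_ideal L).

Section Ladder.
Variable n : nat.
Implicit Types (M N : {pred 'X_{1..n}}) (u v w : 'X_{1..n}).
Implicit Types (t : nat) (a : 'I_n -> int) (i j : 'I_n).

(* Only the entries a i with i < t are meaningful; the second alternative
   encodes the unit ideal. *)
Definition admissible t a : Prop :=
  (1 <= t <= n)%N /\
  ((forall i, (i < t)%N -> 0 <= a i) \/
   (t = 1%N /\ forall i, (i < t)%N -> a i = -1)).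

(* For admissible t a and i < t the absolute values are taken of nonnegative
   integers. *)
Definition delta a i : 'X_{1..n} :=
  [multinom (if (j < i)%N then `|a j|%N
             else if j == i then `|(a j + 1)%R|%N else 0%N) | j < n].

(* U is the ideal (delta_1, ..., delta_t). *)
Definition ulex_form (K : fieldType) (U : {mpoly K[n]} -> Prop) t a : Prop :=
  admissible t a /\
  forall p, U p <->
    ideal_gen_mon (fun m => exists2 i : 'I_n, (i < t)%N & m = delta a i) p.

(* The monomials of K[x_i, ..., x_n]. *)
Definition mon_from i : {pred 'X_{1..n}} :=
  [pred w : 'X_{1..n} | [forall j : 'I_n, (j < i)%N ==> (w j == 0%N)]].

Definition revlex_set i N : Prop :=
  forall u v, u \in N -> v \in mon_from i -> mdeg v = mdeg u ->
    mlex_lt v u -> v \in N.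

Definition multicomplex N : Prop :=
  forall u v, u \in N -> (v <= u)%MM -> v \in N.

(* M_<i>, the part of M in delta_i K[x_i, ..., x_n] divided by delta_i. *)
Definition section_of a M i : {pred 'X_{1..n}} :=
  [pred w | (w \in mon_from i) && ((delta a i + w)%MM \in M)].

Definition ladder_conditions t a M : Prop :=
  (forall i, (i < t)%N ->
     revlex_set i (section_of a M i) /\ multicomplex (section_of a M i)) /\
  (forall i j (d : nat), j = i.+1 :> nat -> (j < t)%N ->
     (exists2 w, w \in section_of a M i & mdeg (delta a i + w)%MM = d) ->
     forall w, w \in mon_from j -> mdeg (delta a j + w)%MM = d ->
       w \in section_of a M j).

(* The pair (t, a restricted to i < t) is determined by U. *)
Definition ladder_set (K : fieldType) (U : {mpoly K[n]} -> Prop) M : Prop :=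
  (forall u, u \in M -> U 'X_[u]) /\
  exists t a, ulex_form U t a /\ ladder_conditions t a M.

(* The 1-based index of the last variable dividing u, and 1 for u = 1. *)
Definition max_var u : nat := maxn 1 (\max_(j < n | u j != 0%N) j.+1).

Definition m_le (k : nat) (M : {fset 'X_{1..n}}) : nat :=
  #|` [fset u in M | (max_var u <= k)%N]%fset|.

Definition m_vec (M : {fset 'X_{1..n}}) : 'I_n -> nat := fun i => m_le i.+1 M.

Definition vec_succeq (b c : 'I_n -> nat) : Prop := forall i, (c i <= b i)%N.

End Ladder.

(* Main.v *)
Require Import Defs.
From HB Require Import structures.
From mathcomp Require Import all_boot all_order all_algebra.
From mathcomp Require Import finmap mpoly zify.
From Stdlib Require Import Classical.

(* Comparing degrees in S[x_{n+1}] shows that the monomials of U are the v with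
   v >= u0, for some u0, in the pure lexicographic order. Hence a ladder set M
   meets each degree d in a lower lex segment of U_d, so that m_{<=k}(M) is a
   function of the sizes h_d of these segments. It is bounded by a function of c
   defined by recursion on the number of variables: after division by the power
   of x_1 in u0, U is the union of a set U' in the remaining variables and of
   x_1 S, and one maximizes over the ways c = A + B of distributing c elements
   over the two parts; the bound is proved by emptying the rows U_d from the top.
   One and the same distribution is a maximum for all k. Therefore N can be built
   from an optimal set N' for U' with B elements and from the A first monomials
   of S, by degree and then in reverse lexicographic order. *)

Set Implicit Arguments.
Unset Strict Implicit.
Unset Printing Implicit Defensive.

(** * Partial sums of rows *)

(** The obstacle is uniformity in [k]. The recursion gives a maximum for each [k], and nothing in it
    makes one distribution attain them all. The induction therefore carries the parametric statement
    [sys_best]: when [z] elements are shared between the lex-smallest monomials of one row in one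
    more variable and the rows of [U] beyond its first [q] ones, some share is best for every [k].
    The alternative at its end, that this share is empty or exhausts all blocks of index at least
    [q], makes the induction close: it leaves only small and large shares to compare at the next
    level. The counts are recursive because, among the monomials of degree d in decreasing lex
    order, those with a fixed power of x_1 form a block, so that a row in one more variable is a
    concatenation of the rows 0 to d of the previous ring. The bound rests on [sys_row] and
    [sys_remove]; the other inequalities on [e] serve the induction and the choice of one
    distribution. *)

Definition cum (s : nat -> nat) (d : nat) := \sum_(i < d) s i.

Lemma cum0 s : cum s 0 = 0.
Proof. by rewrite /cum big_ord0. Qed.

Lemma cumS s d : cum s d.+1 = cum s d + s d.
Proof. by rewrite /cum big_ord_recr. Qed.

Lemma leq_cum s i j : i <= j -> cum s i <= cum s j.
Proof.
by move=> /subnKC <-; elim: (j - i) => [|n IH]; rewrite ?addn0 // addnS cumS; lia.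
Qed.

Lemma leq_cum_id s d : (forall i, 0 < s i) -> d <= cum s d.
Proof. by move=> s0; elim: d => // d IH; rewrite cumS; move: (s0 d); lia. Qed.

Lemma cumP s N : (forall i, 0 < s i) -> exists i x, N = cum s i + x /\ x < s i.
Proof.
move=> s0; elim: N => [|N [i [x [-> xi]]]].
  by exists 0, 0; rewrite cum0 s0.
have [xs|xs] := ltnP x.+1 (s i); first by exists i, x.+1; rewrite addnS.
by exists i.+1, 0; rewrite cumS s0; split=> //; lia.
Qed.

(** [N] elements fill the rows in order, and [F i x] is the count for [x] elements in row [i]. For
    nonempty rows [cum s N] is at least [N], so that the rows from [N] on receive nothing. *)
Definition row_fill (s : nat -> nat) (F : nat -> nat -> nat) (N : nat) :=
  \sum_(i < N) F i (minn (s i) (N - cum s i)).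

Lemma row_fillE s F i x : (forall j, 0 < s j) -> (forall j, F j 0 = 0) ->
  x <= s i -> row_fill s F (cum s i + x) = \sum_(j < i) F j (s j) + F i x.
Proof.
move=> s0 F0 xi.
have step (N M : nat) : N <= M -> \sum_(j < M) F j (minn (s j) (N - cum s j))
    = row_fill s F N.
  move=> /subnKC <-; elim: (M - N) => [|n IH]; first by rewrite addn0.
  rewrite addnS big_ord_recr /= IH.
  have := leq_cum_id (N + n) s0; set c := cum _ _ => h.
  by have -> : N - c = 0 by [lia]; rewrite minn0 F0 addn0.
have le1 : cum s i + x <= cum s i.+1 by rewrite cumS leq_add2l.
rewrite -(step _ (i.+1 + (cum s i + x))); last lia.
suff H K : \sum_(j < i.+1 + K) F j (minn (s j) (cum s i + x - cum s j))
    = \sum_(j < i) F j (s j) + F i x by apply: H.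
elim: K => [|n IH].
  rewrite addn0 big_ord_recr /=; congr (_ + _).
    apply: eq_bigr => j _; congr (F _ _).
    have := @leq_cum s j.+1 i (ltn_ord j); rewrite cumS; lia.
  by congr (F _ _); lia.
rewrite addnS big_ord_recr /= IH.
have := @leq_cum s i.+1 (i.+1 + n) (leq_addr _ _) => h.
set y := (_ - _); have -> : y = 0 by rewrite /y; lia.
by rewrite minn0 F0 addn0.
Qed.

(* [good s L]: a row of length [s d] is the last [s d] letters of one fixed
   word, [L t] counts the marked letters among the last [t] ones, the last
   letters of the word being the densest, and the first ones of a row the
   sparsest among the intervals of that row. *)
Record good (s : nat -> nat) (L : nat -> nat) : Prop := Good {
  good0 : L 0 = 0;
  good_mono : forall x t, L x <= L (x + t);
  good_sub : forall x t, L (x + t) <= L x + L t;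
  good_pre : forall d x t, x + t <= s d -> L (s d) + L x <= L (x + t) + L (s d - t) }.

(** [top] fills each row from its last, densest letters, [bot] from its first, sparsest ones; for
    monomials these are the lex-largest and the lex-smallest. Hence [top s L] is the label count of
    the ring with one more variable, and [bot s L] that of an initial set of monomials. *)
Definition top s (L : nat -> nat) := row_fill s (fun _ => L).
Definition bot s (L : nat -> nat) := row_fill s (fun i x => L (s i) - L (s i - x)).

Section Rows.
Variables (s : nat -> nat) (L : nat -> nat).
Hypothesis s0 : forall i, 0 < s i.
Hypothesis sS : forall i, s i <= s i.+1.
Hypothesis gL : good s L.

Let L0 := good0 gL.
Let Lm := good_mono gL.
Let Ls := good_sub gL.
Let Lp := good_pre gL.

Lemma leq_row i j : i <= j -> s i <= s j.
Proof. by move=> /subnKC <-; elim: (j - i) => [|n IH]; rewrite ?addn0 // addnS (leq_trans IH). Qed.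

Lemma topE i x : x <= s i -> top s L (cum s i + x) = top s L (cum s i) + L x.
Proof.
move=> xi; rewrite /top row_fillE //.
by rewrite -[cum s i in RHS]addn0 row_fillE // L0 addn0.
Qed.

Lemma topS i : top s L (cum s i.+1) = top s L (cum s i) + L (s i).
Proof. by rewrite cumS topE. Qed.

Lemma top_small x : x <= s 0 -> top s L x = L x.
Proof. by move=> x0; rewrite -[x in LHS]add0n -(cum0 s) topE // cum0 /top /row_fill big_ord0. Qed.

Lemma top0 : top s L 0 = 0.
Proof. by rewrite /top /row_fill big_ord0. Qed.

(** Cutting the [t] letters where the rows begin gives pieces that are themselves last letters of
    rows, and [L] is subadditive. *)
Lemma top_chunk i t : L t + top s L (cum s i) <= top s L (cum s i + t).
Proof.
elim/ltn_ind: t i => t IH i.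
have [ti|ti] := leqP t (s i); first by rewrite topE // addnC.
have := IH (t - s i) _ i.+1; rewrite cumS -cumS topS.
have := Ls (s i) (t - s i); move: (s0 i) => si; rewrite subnKC; last lia.
by rewrite cumS -addnA subnKC; last lia; lia.
Qed.

Lemma top_mono x t : top s L x <= top s L (x + t).
Proof.
elim: t => [|t IH]; first by rewrite addn0.
apply: (leq_trans IH); rewrite addnS.
have [i [y [-> yi]]] := cumP (x + t) s0.
by rewrite -addnS !topE //; [rewrite leq_add2l -addn1 Lm | lia].
Qed.

(** An interval that leaves the row where it starts is cut there: the part in that row is compared
    with letters of row [d] by [good_pre], the rest by [top_chunk]. *)
Lemma top_head d t x : t <= s d -> x + t <= cum s d.+1 ->
  L (s d) + top s L x <= top s L (x + t) + L (s d - t).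
Proof.
move=> td xt; have [->|t_gt0] := posnP t; first by rewrite addn0 subn0 addnC.
have [i [y [ex yi]]] := cumP x s0.
have id : i <= d.
  rewrite leqNgt; apply/negP => h; have := leq_cum s h; lia.
have sid := leq_row id.
have [yt|yt] := leqP (y + t) (s i).
  rewrite ex -addnA !topE //; last by lia.
  have := @Lp d y t; lia.
have := top_chunk i.+1 (t - (s i - y)).
have -> : cum s i.+1 + (t - (s i - y)) = x + t by rewrite cumS ex; lia.
rewrite topS ex topE; last lia.
have := @Lp d y (s i - y) _.
have -> : y + (s i - y) = s i by lia.
have := Ls (s d - t) (t - (s i - y)).
have -> : s d - t + (t - (s i - y)) = s d - (s i - y) by lia.
by lia.
Qed.

(** The passage to one more variable. For [good_pre], the first letters of the concatenated word are
    those of the last row that [top] fills; a prefix longer than this row leads back to one row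
    less. *)
Lemma good_top : good (fun d => cum s d.+1) (top s L).
Proof.
split.
- exact: top0.
- exact: top_mono.
- move=> x t; elim/ltn_ind: t => t IH.
  have [->|t_gt0] := posnP t; first by rewrite addn0 leq_addr.
  have [j [y [et yj]]] := cumP t.-1 s0.
  have {}et : t = cum s j + y.+1 by lia.
  have Et : top s L t = top s L (cum s j) + L y.+1 by rewrite et topE.
  have := IH (cum s j).
  have [i [z [ex zi]]] := cumP (x + cum s j) s0.
  have ji : j <= i.
    rewrite leqNgt; apply/negP => h; have := leq_cum s h; rewrite cumS; lia.
  have sji := leq_row ji.
  suff : top s L (x + t) <= top s L (x + cum s j) + L y.+1 by lia.
  rewrite [in X in X <= _]et addnA ex -addnA.
  have [zy|zy] := leqP (z + y.+1) (s i).
    by rewrite !topE //; [move: (Ls z y.+1); lia | lia].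
  have -> : cum s i + (z + y.+1) = cum s i.+1 + (y.+1 - (s i - z)).
    by rewrite cumS; lia.
  have sy := sS i.
  rewrite topE; last by lia.
  rewrite topS topE; last lia.
  have := @Lp i (y.+1 - (s i - z)) (s i - z).
  have -> : y.+1 - (s i - z) + (s i - z) = y.+1 by lia.
  by have -> : s i - (s i - z) = z by [lia]; lia.
- move=> d; elim: d => [|d IH] x t xt.
    have := @top_head 0 t x; rewrite !cumS !cum0 !add0n in xt *.
    by rewrite !(@top_small (s 0)) // (@top_small (s 0 - t)) //; lia.
  have [td|td] := leqP t (s d.+1).
    have := @top_head d.+1 t x td xt.
    have -> : cum s d.+2 - t = cum s d.+1 + (s d.+1 - t) by rewrite cumS; lia.
    by rewrite topS topE; [lia | lia].
  have h1 : x + (t - s d.+1) <= cum s d.+1 by move: xt; rewrite cumS; lia.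
  have := IH x (t - s d.+1) h1.
  have := @top_head d.+1 (s d.+1) (x + (t - s d.+1)) (leqnn _).
  have -> : x + (t - s d.+1) + s d.+1 = x + t by lia.
  rewrite subnn L0 addn0 (topS d.+1) => /(_ xt).
  have -> : cum s d.+2 - t = cum s d.+1 - (t - s d.+1) by rewrite cumS; lia.
  by lia.
Qed.

Lemma botE i x : x <= s i ->
  bot s L (cum s i + x) + L (s i - x) = bot s L (cum s i) + L (s i).
Proof.
have F0 j : L (s j) - L (s j - 0) = 0 by rewrite subn0 subnn.
move=> xi; rewrite /bot row_fillE //.
rewrite -[cum s i in RHS]addn0 row_fillE // subn0 subnn addn0.
have := Lm (s i - x) x; rewrite subnK //; lia.
Qed.

Lemma botS i : bot s L (cum s i.+1) = bot s L (cum s i) + L (s i).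
Proof. by have := @botE i (s i) (leqnn _); rewrite subnn L0 addn0 -cumS. Qed.

Lemma bot0 : bot s L 0 = 0.
Proof. by rewrite /bot /row_fill big_ord0. Qed.

Lemma bot_top i : bot s L (cum s i) = top s L (cum s i).
Proof. by elim: i => [|i IH]; rewrite ?cum0 ?bot0 ?top0 // botS topS IH. Qed.

(** A window across two rows takes the dense end of row [j] and the sparse beginning of row [j.+1].
    By [t <= s i.+1] its length fits into row [j.+1], where [good_pre] compares the two pieces with
    the last [t] letters. *)
Lemma bot_window i N t : cum s i <= N -> t <= s i.+1 ->
  bot s L (N + t) <= bot s L N + L t.
Proof.
move=> iN ti; have [j [x [eN xj]]] := cumP N s0.
have ij : i <= j.
  rewrite leqNgt; apply/negP => h; have := leq_cum s h; rewrite cumS; lia.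
have sij : s i.+1 <= s j.+1 by apply: leq_row.
have [xt|xt] := leqP (x + t) (s j).
  have := botE xt; have := botE (ltnW xj); rewrite eN addnA.
  have := Ls (s j - (x + t)) t; have -> : s j - (x + t) + t = s j - x by lia.
  by lia.
have := @botE j.+1 (t - (s j - x)) _; rewrite botS.
have -> : cum s j.+1 + (t - (s j - x)) = N + t by rewrite cumS eN; lia.
have := botE (ltnW xj); rewrite -eN.
have := @Lp j.+1 (s j - x) (t - (s j - x)).
have -> : s j - x + (t - (s j - x)) = t by lia.
by lia.
Qed.

Lemma bot_window_top i N M : cum s i <= N -> cum s i <= M ->
  bot s L (N + (M - cum s i)) + top s L (cum s i) <= bot s L N + top s L M.
Proof.
elim/ltn_ind: M N => M IH N iN iM.
have [eM|Mi] := eqVneq M (cum s i).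
  by rewrite eM subnn addn0.
have [j [y [et yj]]] := cumP M.-1 s0.
have {}et : M = cum s j + y.+1 by lia.
have Et : top s L M = top s L (cum s j) + L y.+1 by rewrite et topE.
have ij : cum s i <= cum s j.
  apply: leq_cum; rewrite leqNgt; apply/negP => h.
  by have := leq_cum s h; rewrite cumS; lia.
have := IH (cum s j) _ N iN ij.
have := @bot_window j (N + (cum s j - cum s i)) y.+1 _ _.
have -> : N + (cum s j - cum s i) + y.+1 = N + (M - cum s i) by lia.
by have := sS j; lia.
Qed.

(** The letters that [bot] has left out of its current row are the last ones. Once they are
    supplied, the row is complete and [bot] agrees with [top]. *)
Lemma bot_add_top A v : bot s L A + L v <= top s L (A + v).
Proof.
have [i [a [eA ai]]] := cumP A s0.
have := botE (ltnW ai); rewrite -eA bot_top.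
have [av|av] := leqP (a + v) (s i).
  rewrite eA -addnA topE // -eA.
  by have := @Lp i v a; rewrite addnC; move/(_ av); rewrite addnC; lia.
have := top_chunk i.+1 (v - (s i - a)); rewrite topS.
have -> : cum s i.+1 + (v - (s i - a)) = A + v by rewrite cumS eA; lia.
have := Ls (s i - a) (v - (s i - a)).
by have -> : s i - a + (v - (s i - a)) = v by [lia]; lia.
Qed.

Lemma bot_fill p N y : y <= s p -> N + y <= cum s p.+1 ->
  bot s L N + L (s p) <= bot s L (N + y) + L (s p - y).
Proof.
elim/ltn_ind: y N => y IH N yp Ny.
have [->|y0] := posnP y; first by rewrite addn0 subn0.
have [i [a [eN ai]]] := cumP N s0.
have ip : i <= p.
  rewrite leqNgt; apply/negP => h; have := leq_cum s h; lia.
have sip := leq_row ip.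
have Ea := botE (ltnW ai); rewrite -eN in Ea.
have [ay|ay] := leqP (a + y) (s i).
  have := botE ay; rewrite addnA -eN.
  have := @Lp p (s i - (a + y)) y.
  have -> : s i - (a + y) + y = s i - a by lia.
  by lia.
have := IH (y - (s i - a)) _ (cum s i.+1) _ _; rewrite botS.
have -> : cum s i.+1 + (y - (s i - a)) = N + y by rewrite cumS eN; lia.
have := Ls (s p - y) (s i - a).
have -> : s p - y + (s i - a) = s p - (y - (s i - a)) by lia.
by lia.
Qed.

End Rows.

(** * Adding a variable *)

(* [s d] and [u d]: number of monomials of degree [d] of the polynomial ring
   and of a lex upper set [U] divided by its largest common power of the first
   variable; [L k t]: number of monomials in the variables of index at most [k]
   (counted from 0) among the [t] lex-largest ones of a given degree; [e k c]:
   the maximum of that number over the ladder sets with [c] elements. *)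
Record system (s : nat -> nat) (L : nat -> nat -> nat) (u : nat -> nat)
    (e : nat -> nat -> nat) : Prop := System {
  sys_pos : forall i, 0 < s i;
  sys_size0 : s 0 = 1;
  sys_homo : forall i, s i <= s i.+1;
  sys_good : forall k, good s (L k);
  sys_uhomo : forall i, u i <= u i.+1;
  sys_us : forall i, u i <= s i;
  sys_window : forall k B t, e k (B + t) <= e k B + top s (L k) t;
  sys_remove : forall k q C t, cum u q.+1 <= C -> t <= u q ->
    e k C <= e k (C - t) + L k t;
  sys_row : forall k q, e k (cum u q.+1) = e k (cum u q) + L k (u q);
  sys_complete : forall k q w, w <= u q -> exists2 h, h <= w &
    e k (cum u q + w) + L k (u q - h) <= e k (cum u q.+1 + (w - h));
  sys_best : forall p q z, z < cum s p -> exists y, [/\ y <= z,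
    forall k x, x <= z -> top s (L k) (cum s p - y) + e k (cum u q + z - x) <=
                          top s (L k) (cum s p - x) + e k (cum u q + z - y) &
    y = 0 \/ cum s p <= y + cum s q] }.

Definition shift_row b (u : nat -> nat) d := if d < b then 0 else u (d - b).

Lemma cum_shift_row b u q : cum (shift_row b u) q = cum u (q - b).
Proof.
elim: q => [|q IH]; first by rewrite sub0n !cum0.
rewrite cumS IH /shift_row; case: ltnP => qb.
  by rewrite addn0; congr (cum u); lia.
by rewrite subSn // cumS.
Qed.

Section Step.
Variables (s : nat -> nat) (L : nat -> nat -> nat) (u0 : nat -> nat).
Variables (e : nat -> nat -> nat) (b : nat).
Hypothesis sys : system s L u0 e.

(* With one more variable [y] in front, the upper set becomes the union of the
   previous one, [U'], and of all the multiples of [y]. The label counts are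
   [step_raw] for the part in [U'], of size [B], and [bot step_size] for the
   other one, of size [A]; condition (ii) on ladder sets is [step_valid A B]. *)
Local Notation u := (shift_row b u0).
Definition step_lab k := if k is k'.+1 then top s (L k') else minn 1.
Definition step_raw k := if k is k'.+1 then e k'
  else fun B => minn 1 (minn (shift_row b u0 0) B).
Local Notation G := step_lab.
Local Notation E := step_raw.
Definition step_size d := cum s d.+1.
Local Notation sz := step_size.
Definition step_row d := shift_row b u0 d + cum s d.
Local Notation U := step_row.
Definition step_valid A B :=
  [forall d : 'I_A, (cum step_size d < A) ==> (cum (shift_row b u0) d.+2 <= B)].
Definition step_opt k C := \max_(A < C.+1 | step_valid A (C - A))
   (bot step_size (step_lab k) A + step_raw k (C - A)).
Local Notation e' := step_opt.

Let s0 := sys_pos sys.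
Let sS := sys_homo sys.
Let gL := sys_good sys.

Lemma gam_good k : good sz (G k).
Proof.
case: k => [|k]; last exact: good_top.
by split=> //= *; lia.
Qed.

Lemma S_gt0 i : 0 < sz i.
Proof. by rewrite /step_size cumS; move: (s0 i); lia. Qed.

Lemma S_homo i : sz i <= sz i.+1.
Proof. exact: leq_cum. Qed.

Lemma S_mono i j : i <= j -> sz i <= sz j.
Proof. by move=> ij; apply: leq_cum. Qed.

Local Notation P k := (bot sz (G k)).
Local Notation T k := (top sz (G k)).
Let cS d : cum sz d.+1 = cum sz d + sz d. Proof. exact: cumS. Qed.

Lemma u_homo i : u i <= u i.+1.
Proof.
rewrite /shift_row; case: ltnP => // ib; case: ltnP => [|ib']; first lia.
by rewrite subSn ?ib // (sys_uhomo sys).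
Qed.

Lemma u_le i : u i <= s i.
Proof.
rewrite /shift_row; case: ltnP => // ib.
by apply: leq_trans (sys_us sys _) _; apply: leq_row => //; lia.
Qed.

Lemma raw_window k B t : E k (B + t) <= E k B + G k t.
Proof. by case: k => [|k] /=; [lia | exact: (sys_window sys)]. Qed.

Lemma raw_remove k q C t : cum u q.+1 <= C -> t <= u q ->
  E k.+1 C <= E k.+1 (C - t) + L k t.
Proof.
rewrite cum_shift_row /shift_row; case: ltnP => [_ _|qb].
  by rewrite leqn0 => /eqP ->; rewrite subn0 leq_addr.
by rewrite subSn //; apply: (sys_remove sys).
Qed.

Lemma raw_row k q : E k.+1 (cum u q.+1) = E k.+1 (cum u q) + L k (u q).
Proof.
rewrite !cum_shift_row /shift_row; case: ltnP => qb.
  by rewrite (good0 (gL k)) addn0; congr (e k (cum u0 _)); lia.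
by rewrite subSn //; apply: (sys_row sys).
Qed.

Lemma raw_complete k q w : w <= u q -> exists2 h, h <= w &
  E k.+1 (cum u q + w) + L k (u q - h) <= E k.+1 (cum u q.+1 + (w - h)).
Proof.
rewrite !cum_shift_row /shift_row; case: ltnP => qb.
  rewrite leqn0 => /eqP ->; exists 0 => //.
  rewrite subn0 (good0 (gL k)) !addn0; suff -> : q.+1 - b = q - b by [].
  lia.
by rewrite subSn //; apply: (sys_complete sys).
Qed.

(** For the label 0 only the monomial 1 of [U'] counts, and it is in [U'] exactly when row 0 is
    nonempty. *)
Lemma raw0 q B : cum u q.+1 <= B -> E 0 B = minn 1 (u 0).
Proof.
by move=> h; have := @leq_cum u 1 q.+1; rewrite cumS cum0 /=; lia.
Qed.

Lemma raw_best p q z : z < cum s p -> exists y, [/\ y <= z,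
  forall k x, x <= z -> G k (cum s p - y) + E k (cum u q + z - x) <=
                        G k (cum s p - x) + E k (cum u q + z - y) &
  y = 0 \/ cum s p <= y + cum s q].
Proof.
move=> zp; have [y [yz best dich]] := sys_best sys (q - b) zp.
exists y; split=> //; last first.
  case: dich; [by left | right]; have := @leq_cum s (q - b) q; lia.
case=> [|k] x xz; last by rewrite cum_shift_row; apply: best.
rewrite /=; have -> : minn 1 (cum s p - y) = 1 by lia.
have -> : minn 1 (cum s p - x) = 1 by lia.
rewrite leq_add2l; case: dich => [-> | h]; first lia.
case: q h best => [|q]; first by rewrite sub0n cum0; lia.
move=> h _; have : cum u q.+1 <= cum u q.+1 + z - y by lia.
move=> /raw0; rewrite /=; lia.
Qed.

Lemma validP A B : reflect (forall d, cum sz d < A -> cum u d.+2 <= B) (step_valid A B).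
Proof.
apply: (iffP forallP) => [h d dA | h d]; last by apply/implyP => /h.
have dA' : d < A by apply: leq_ltn_trans dA; apply: leq_cum_id S_gt0.
by have := h (Ordinal dA'); rewrite /= dA.
Qed.

Lemma valid_sub A B A' : A' <= A -> step_valid A B -> step_valid A' B.
Proof. by move=> AA /validP h; apply/validP => d dA; apply: h; lia. Qed.

Lemma valid_row q B : cum u q <= B -> step_valid (cum sz q.-1) B.
Proof.
move=> h; apply/validP => d dq; apply: leq_trans h; apply: leq_cum.
by rewrite ltnNge; apply/negP => qd; have := @leq_cum sz q.-1 d; lia.
Qed.

Lemma opt_ge k A B : step_valid A B -> P k A + E k B <= e' k (A + B).
Proof.
move=> v; have AC : A < (A + B).+1 by lia.
have := @leq_bigmax_cond _ (fun i : 'I_(A + B).+1 => step_valid i (A + B - i))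
  (fun i => P k i + E k (A + B - i)) (Ordinal AC).
by rewrite /= addKn; apply.
Qed.

Lemma opt_ex k C : exists A B, [/\ A + B = C, step_valid A B & e' k C = P k A + E k B].
Proof.
have v0 : step_valid (ord0 : 'I_C.+1) (C - (ord0 : 'I_C.+1)).
  by apply/validP => d; rewrite ltn0.
have := @eq_bigmax_cond 'I_C.+1 (fun A => step_valid A (C - A))
   (fun A => P k A + E k (C - A)).
case=> [|A vA eq]; first by apply/card_gt0P; exists ord0.
exists A, (C - A); split=> //; by have := ltn_ord A; lia.
Qed.

(** Row [i] of the multiples of the new variable lies in degree [i.+1], whence [q.-1]. The same
    shift explains [d.+2] in [step_valid]. *)
Lemma cum_U q : cum U q = cum u q + cum sz q.-1.
Proof.
elim: q => [|[|q] IH]; rewrite ?cum0 //.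
  by rewrite !cumS !cum0 /= /step_row cum0; lia.
rewrite cumS IH [in RHS]cumS /= [cum sz q.+1]cumS /step_row -/(step_size q); lia.
Qed.

Lemma P_win k i N t : cum sz i <= N -> t <= sz i.+1 -> P k (N + t) <= P k N + G k t.
Proof. exact: (bot_window S_gt0 S_homo (gam_good k)). Qed.

Lemma P_row k i x : x <= sz i -> P k (cum sz i + x) + G k (sz i - x) = P k (cum sz i) + G k (sz i).
Proof. exact: (botE S_gt0 (gam_good k)). Qed.

Lemma P_rowS k i : P k (cum sz i.+1) = P k (cum sz i) + G k (sz i).
Proof. exact: (botS S_gt0 (gam_good k)). Qed.

(** Elements can be moved from [U'] into an incomplete row of the multiples: by [raw_window] the
    loss of [t] of them is at most [G k t], and the last [t] monomials of the row are worth exactly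
    that. So the rows are completed one after the other without loss. *)
Lemma opt_full k q C : cum U q <= C -> exists A B,
  [/\ A + B = C, step_valid A B, e' k C = P k A + E k B & cum sz q.-1 <= A /\ cum u q <= B].
Proof.
rewrite cum_U => qC.
suff [A [B [AB v eq qA]]] : exists A B,
  [/\ A + B = C, step_valid A B, e' k C = P k A + E k B & cum sz q.-1 <= A].
  exists A, B; split=> //; split=> //.
  have [Aq|Aq] := eqVneq A (cum sz q.-1); first by lia.
  have /(validP _ _ v) : cum sz q.-1 < A by lia.
  apply: leq_trans; apply: leq_cum; lia.
have : q.-1 <= q.-1 by []; elim: {-2}(q.-1) => [|r IH] rq.
  have [A [B [AB v eq]]] := opt_ex k C; exists A, B; split=> //.
  by rewrite cum0.
have [A [B [AB v eq rA]]] := IH (ltnW rq).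
have [rA'|rA'] := leqP (cum sz r.+1) A; first by exists A, B; split.
have hS : cum sz r.+1 <= cum sz q.-1 by apply: leq_cum.
have hu : cum u r.+2 <= cum u q by apply: leq_cum; lia.
exists (cum sz r.+1), (C - cum sz r.+1).
have v' : step_valid (cum sz r.+1) (C - cum sz r.+1).
  by apply: (@valid_row r.+2); lia.
split=> //; first lia.
apply/eqP; rewrite eqn_leq; apply/andP; split; last first.
  have {2}-> : C = cum sz r.+1 + (C - cum sz r.+1) by lia.
  exact: opt_ge.
rewrite eq; have h := raw_window k (C - cum sz r.+1) (cum sz r.+1 - A).
have hB : C - cum sz r.+1 + (cum sz r.+1 - A) = B by lia.
rewrite hB in h.
have aS : A - cum sz r <= sz r by rewrite cS in rA'; lia.
have := P_row k aS; rewrite subnKC // -P_rowS.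
have -> : sz r - (A - cum sz r) = cum sz r.+1 - A by rewrite cS; lia.
by lia.
Qed.

Lemma opt_window k C t : e' k (C + t) <= e' k C + T k t.
Proof.
have gk := gam_good k.
have [A [B [AB v ->]]] := opt_ex k (C + t).
have [tA|tA] := leqP t A.
  have v' : step_valid (A - t) B by apply: valid_sub v; lia.
  have := opt_ge k v'; have -> : A - t + B = C by lia.
  have := @bot_window_top sz (G k) S_gt0 S_homo gk 0 (A - t) t.
  by rewrite cum0 subn0 top0 subnK //; lia.
have v' : step_valid 0 (B - (t - A)) by apply/validP => d; rewrite ltn0.
have := opt_ge k v'; rewrite bot0 add0n add0n.
have -> : B - (t - A) = C by lia.
have := raw_window k C (t - A); have -> : C + (t - A) = B by lia.
have := @bot_add_top sz (G k) S_gt0 gk A (t - A); rewrite subnKC ?(ltnW tA) //.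
by lia.
Qed.

Lemma gam_chunk k i x : x <= s i -> G k.+1 (cum s i + x) = G k.+1 (cum s i) + L k x.
Proof. exact: topE. Qed.

Lemma U_le i : U i <= sz i.
Proof. by rewrite /step_row /step_size cumS addnC leq_add2l u_le. Qed.

Lemma opt_remove k q C t : cum U q.+1 <= C -> t <= U q ->
  e' k C <= e' k (C - t) + G k t.
Proof.
have gk := gam_good k.
move=> qC tU; have [A [B [AB v -> [Aq Bq]]]] := opt_full k qC.
have [tA|tA] := leqP (cum sz q.-1 + t) A.
  have v' : step_valid (A - t) B by apply: valid_sub v; lia.
  have := opt_ge k v'; have -> : A - t + B = C - t by lia.
  have tS : t <= sz q.-1.+1.
    by apply: leq_trans tU _; apply: leq_trans (U_le q) _; apply: S_mono; lia.
  have := @P_win k q.-1 (A - t) t ltac:(lia) tS; rewrite subnK; last lia.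
  by lia.
case: q qC tU Aq Bq tA => [|q] /= qC tU Aq Bq tA.
  have tB : t <= B by move: tU Bq; rewrite /step_row cumS !cum0; lia.
  have A0 : A = 0.
    by move: tU (u_le 0); rewrite /step_row cum0 (sys_size0 sys) cum0 in tA *; lia.
  have v' : step_valid A (B - t) by rewrite A0; apply/validP => d; rewrite ltn0.
  have := opt_ge k v'; have := raw_window k (B - t) t; rewrite subnK //.
  by have -> : A + (B - t) = C - t by [lia]; lia.
have eU : U q.+1 = u q.+1 + sz q by [].
(* What is removed consists of the [a] monomials of the incomplete row, the complete row [sz q] and
   [r.+1] monomials of [U']. As [a + r.+1] is at most [s q.+1], [good_pre] in a single row of the
   smaller ring bounds the first and third losses together. *)
have [a ea] : exists a, A = cum sz q.+1 + a by exists (A - cum sz q.+1); lia.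
rewrite cS in ea.
have [r er] : exists r, t = sz q + (a + r.+1) by exists (t - sz q - a).-1; lia.
have v' : step_valid (cum sz q) (B - r.+1).
  apply: (@valid_row q.+1); move: Bq; rewrite cumS; lia.
have rB : r.+1 <= B by move: Bq; rewrite cumS; lia.
have := opt_ge k v'; have -> : cum sz q + (B - r.+1) = C - t by lia.
have aS : a <= sz q.+1 by have := u_le q.+1; rewrite /step_size cumS; lia.
have := P_row k aS; rewrite P_rowS cS -ea.
case: k gk => [|k] gk.
  have := S_gt0 q; have := S_gt0 q.+1.
  have : 0 < sz q.+1 - a.
    by have := u_le q.+1; rewrite /step_size cumS; lia.
  have h1 : cum u 1 <= B - r.+1.
    have := @leq_cum u 1 q.+1; move: Bq; rewrite cumS; lia.
  have h2 : cum u 1 <= B by lia.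
  by rewrite (raw0 h1) (raw0 h2) /=; lia.
rewrite er eU in tU *; have := @raw_remove k q.+1 B r.+1 Bq ltac:(lia).
have ar : a + r.+1 <= s q.+1 by have := u_le q.+1; lia.
rewrite [sz q]/step_size gam_chunk //.
have -> : sz q.+1 - a = cum s q.+1 + (s q.+1 - a) by rewrite /step_size cumS; lia.
rewrite gam_chunk; last lia.
have -> : G k.+1 (sz q.+1) = G k.+1 (cum s q.+1) + L k (s q.+1).
  by rewrite /step_size cumS gam_chunk.
have := good_pre (gL k) (d := q.+1) (x := r.+1) (t := a).
by rewrite [r.+1 + a]addnC => /(_ ar); lia.
Qed.

Lemma opt_window_row k q C t : cum U q <= C -> t <= cum s q ->
  e' k (C + t) <= e' k C + G k t.
Proof.
case: q => [|q] qC tq; first by rewrite cum0 leqn0 in tq; rewrite (eqP tq) addn0 leq_addr.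
have gk := gam_good k.
have [A [B [AB v -> [/= Aq Bq]]]] := @opt_full k q.+1 (C + t) (leq_trans qC (leq_addr _ _)).
have [tA|tA] := leqP (cum sz q + t) A.
  have v' : step_valid (A - t) B by apply: valid_sub v; lia.
  have := opt_ge k v'; have -> : A - t + B = C by lia.
  have := @P_win k q (A - t) t ltac:(lia) (leq_trans tq (S_homo q)); rewrite subnK; last lia.
  by lia.
have v' : step_valid (cum sz q) (B - (t - (A - cum sz q))).
  by apply: (@valid_row q.+1); move: qC; rewrite cum_U /=; lia.
have := opt_ge k v'.
have -> : cum sz q + (B - (t - (A - cum sz q))) = C by move: qC; rewrite cum_U /=; lia.
have := raw_window k (B - (t - (A - cum sz q))) (t - (A - cum sz q)).
rewrite subnK; last by move: qC; rewrite cum_U /=; lia.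
have eS : sz q = cum s q.+1 by [].
have aS : A - cum sz q <= sz q by lia.
have := P_row k aS; rewrite subnKC //.
have := good_pre gk (d := q) (x := t - (A - cum sz q)) (t := A - cum sz q).
by rewrite subnK; last lia; move=> /(_ tq); lia.
Qed.

Lemma opt_row k q : e' k (cum U q.+1) = e' k (cum U q) + G k (U q).
Proof.
have full r : e' k (cum U r) = P k (cum sz r.-1) + E k (cum u r).
  have [A [B [AB v -> [Ar Br]]]] := @opt_full k r _ (leqnn _).
  by move: AB; rewrite cum_U => AB; congr (P k _ + E k _); lia.
rewrite !full /step_row; case: q => [|q] /=.
  rewrite !cum0 addn0 bot0 add0n; case: k {full} => [|k].
    by rewrite /= cumS cum0; lia.
  rewrite raw_row cum0 /= top_small //; last exact: u_le.
rewrite P_rowS; case: k {full} => [|k].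
  rewrite (raw0 (leqnn (cum u q.+2))) (raw0 (leqnn (cum u q.+1))).
  by rewrite /=; have := S_gt0 q; rewrite /step_size; lia.
rewrite raw_row /step_size addnC (addnC (u _)) gam_chunk; last exact: u_le.
by lia.
Qed.

(** [h] is the number of those among the [w] elements that lie in row [q]; the others lie higher,
    and the missing elements of row [q] are its lex-largest ones. If the part of row [q] in [U'] is
    incomplete, validity excludes multiples of the new variable there, and [h] comes from the level
    below. *)
Lemma opt_complete k q w : w <= U q -> exists2 h, h <= w &
  e' k (cum U q + w) + G k (U q - h) <= e' k (cum U q.+1 + (w - h)).
Proof.
move=> wU; have [A [B [AB v -> [Aq Bq]]]] := @opt_full k q _ (leq_addr w (cum U q)).
have eP a : a <= cum s q -> P k (cum sz q.-1 + a) + G k (cum s q - a) = P k (cum sz q).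
  case: q {wU AB Aq Bq} => [|q] aq /=.
    by move: aq; rewrite !cum0 leqn0 => /eqP ->; rewrite subnn (good0 (gam_good k)) !addn0.
  by rewrite P_row // P_rowS.
have eU : U q = u q + cum s q by [].
have [Bq'|Bq'] := leqP (cum u q.+1) B.
  have v' : step_valid (cum sz q) B by apply: (@valid_row q.+1).
  have := opt_ge k v'; rewrite cum_U in AB; rewrite cumS in Bq'.
  exists (u q + (A - cum sz q.-1)); first by lia.
  have := eP (A - cum sz q.-1); rewrite subnKC // => /(_ ltac:(lia)).
  have -> : U q - (u q + (A - cum sz q.-1)) = cum s q - (A - cum sz q.-1) by lia.
  have -> : cum U q.+1 + (w - (u q + (A - cum sz q.-1))) = cum sz q + B.
    by rewrite cum_U cumS /=; lia.
  by lia.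
have {}Aq : A = cum sz q.-1.
  apply/eqP; rewrite eqn_leq Aq andbT leqNgt; apply/negP => /(validP _ _ v).
  have := @leq_cum u q.+1 q.-1.+2; lia.
have eB : B = cum u q + w by move: AB; rewrite cum_U Aq; lia.
have wu : w < u q by move: Bq'; rewrite cumS; lia.
have vr r : step_valid (cum sz q) (cum u q.+1 + r) by apply: (@valid_row q.+1); rewrite leq_addr.
have := eP 0 (leq0n _); rewrite addn0 subn0 -Aq => eP0.
have eUq r : cum sz q + (cum u q.+1 + r) = cum U q.+1 + r by rewrite cum_U /=; lia.
case: k eP eP0 => [|k] eP eP0.
  exists w => //; rewrite subnn addn0.
  have := opt_ge 0 (vr 0); rewrite eUq !addn0 (raw0 (leqnn _)).
  move: eP0; rewrite /=.
  case: q wU eU AB v Bq Bq' Aq eB wu vr eP eUq => [|q] wU eU AB v Bq Bq' Aq eB wu vr eP eUq.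
    rewrite cum0 in eU; rewrite cum0 in eB.
    by have := u_le 0; rewrite (sys_size0 sys) /=; lia.
  by rewrite eB /=; have := leq_cum_id q.+1 s0; lia.
have [h hw hh] := raw_complete k (ltnW wu); exists h => //.
have := opt_ge k.+1 (vr (w - h)); rewrite eUq eB.
have -> : U q - h = cum s q + (u q - h) by rewrite eU; lia.
by rewrite gam_chunk; [lia | have := u_le q; lia].
Qed.

(* [G k (sz p) - G k (sz p - y)] is the number of marked elements among the
   first [y] ones of row [p]. *)
Lemma opt_prefix k p q W y : cum U q <= W -> W + y <= cum U p.+1 -> y <= sz p ->
  e' k W + G k (sz p) <= e' k (W + y) + G k (sz p - y).
Proof.
have gk := gam_good k.
elim: {q}(p.+1 - q) {-2}q (erefl (p.+1 - q)) W y => [|n IH] q nq W y qW Wp yS.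
  have := @leq_cum U p.+1 q; have -> : y = 0 by have := @leq_cum U p.+1 q; lia.
  by rewrite addn0 subn0.
have [qW'|qW'] := leqP (cum U q.+1) W; first by apply: (IH q.+1) => //; lia.
have eW : W = cum U q + (W - cum U q) by lia.
have wU : W - cum U q <= U q by move: qW'; rewrite cumS; lia.
have [h hw] := opt_complete k wU; rewrite -eW.
have USp : U q <= sz p by apply: leq_trans (U_le q) _; apply: S_mono; lia.
have [yh|yh] := leqP y (U q - h).
  have := @opt_remove k q (cum U q.+1 + (W - cum U q - h)) (U q - h - y) (leq_addr _ _).
  have -> : cum U q.+1 + (W - cum U q - h) - (U q - h - y) = W + y by rewrite cumS; lia.
  have := good_pre gk (d := p) (x := U q - h - y) (t := y).
  by rewrite subnK // => h1 /(_ _) h2; move: h1 h2; case: (leqP (U q - h) (sz p)); lia.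
have := IH q.+1 _ (cum U q.+1 + (W - cum U q - h)) (y - (U q - h)).
have -> : cum U q.+1 + (W - cum U q - h) + (y - (U q - h)) = W + y by rewrite cumS; lia.
move=> /(_ _ (leq_addr _ _) Wp) h1 h2; have {}h1 := h1 ltac:(lia) ltac:(lia).
have := good_sub gk (sz p - y) (U q - h).
by have -> : sz p - y + (U q - h) = sz p - (y - (U q - h)) by [lia]; lia.
Qed.

(** The comparison in [sys_best], one level up: the share [y] leaves [cum sz p - y] letters of the
    word and gives the other [z - y] elements to the upper set. Terms are placed so that only [y]
    and [x] are subtracted. *)
Definition beats p q z k y x :=
  T k (cum sz p - y) + e' k (cum U q + z - x) <=
  T k (cum sz p - x) + e' k (cum U q + z - y).

Lemma beats_trans p q z k y x w :
  beats p q z k y x -> beats p q z k x w -> beats p q z k y w.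
Proof. by rewrite /beats; lia. Qed.

Lemma beats_shift p q z k c y x : c <= cum sz p -> c <= z ->
  forall p', cum sz p' = cum sz p - c ->
  beats p' q (z - c) k y x -> beats p q z k (c + y) (c + x).
Proof.
move=> cp cz p' ep; rewrite /beats ep !subnDA.
by have -> : cum U q + (z - c) = cum U q + z - c by lia.
Qed.

Lemma cum_US q r : q <= r -> cum U r + cum sz q <= cum U q + cum sz r.
Proof.
move=> /subnKC <-; elim: (r - q) => [|n IH]; first by rewrite addn0.
by rewrite addnS !cumS; have := U_le (q + n); lia.
Qed.

Lemma T_chunk k i x : x <= sz i -> T k (cum sz i + x) = T k (cum sz i) + G k x.
Proof. by apply: topE => //; [exact: S_gt0 | exact: gam_good]. Qed.

Lemma P_T k i : P k (cum sz i) = T k (cum sz i).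
Proof. by apply: bot_top; [exact: S_gt0 | exact: gam_good]. Qed.

(** Either [z] suffices for the whole row [p], which is then worth taking by [opt_window_row], and
    [p] decreases; or only this row can be touched, and the optimum of the level below solves the
    problem. *)
Lemma opt_best_far p q z : p <= q -> z < cum sz p -> exists2 y, y <= z &
  forall k x, x <= z -> beats p q z k y x.
Proof.
elim: p z => [|p IH] z pq; first by rewrite cum0.
move=> zp; have Sq : sz p <= cum s q by apply: leq_cum.
have [Sz|zS] := leqP (sz p) z.
  have [y1 y1z best] := IH (z - sz p) (ltnW pq) ltac:(rewrite cS in zp; lia).
  have lift k x : sz p <= x <= z -> beats p.+1 q z k (sz p + y1) x.
    move=> /andP[Sx xz]; have -> : x = sz p + (x - sz p) by lia.
    by apply: (@beats_shift _ _ _ _ _ _ _ _ _ p); [rewrite cS; lia | | rewrite cS; lia | apply: best; lia].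
  exists (sz p + y1); first lia.
  move=> k x xz; have [Sx|xS] := leqP (sz p) x; first by apply: lift; rewrite Sx.
  apply: beats_trans (lift k (sz p) _) _; first by rewrite leqnn.
  rewrite /beats; have -> : cum sz p.+1 - sz p = cum sz p by rewrite cS; lia.
  have -> : cum sz p.+1 - x = cum sz p + (sz p - x) by rewrite cS; lia.
  rewrite T_chunk ?leq_subr //.
  have := @opt_window_row k q (cum U q + z - sz p) (sz p - x).
  have -> : cum U q + z - sz p + (sz p - x) = cum U q + z - x by lia.
  by move=> h; have := h ltac:(lia) ltac:(lia); lia.
have [y [yz best _]] := @raw_best p.+1 q z zS.
exists y => // k x xz; rewrite /beats.
have eT w : w <= z -> T k (cum sz p.+1 - w) = T k (cum sz p) + G k (sz p - w).
  move=> wz; have -> : cum sz p.+1 - w = cum sz p + (sz p - w) by rewrite cS; lia.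
  by rewrite T_chunk ?leq_subr.
rewrite !eT //.
case: q {IH} pq Sq best => // q pq Sq best.
have [A [B [AB v -> [/= Aq Bq]]]] := @opt_full k q.+1 (cum U q.+1 + z - x) ltac:(lia).
have vy : step_valid (cum sz q) (cum u q.+1 + z - y) by apply: (@valid_row q.+1); lia.
have := opt_ge k vy; rewrite cum_U /= in AB *.
have -> : cum sz q + (cum u q.+1 + z - y) = cum u q.+1 + cum sz q + z - y by lia.
have Spq : sz p <= sz q by apply: S_mono; lia.
have aS : A - cum sz q <= sz q by lia.
have := P_row k aS; rewrite subnKC //.
(* The multiples beyond the complete rows are counted as further letters of row [p], which gives a
   competitor at the level below. *)
have := best k (x + (A - cum sz q)) ltac:(lia).
have -> : cum u q.+1 + z - (x + (A - cum sz q)) = B by lia.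
have := good_pre (gam_good k) (d := q) (x := sz p - (x + (A - cum sz q))) (t := A - cum sz q).
have -> : sz p - (x + (A - cum sz q)) + (A - cum sz q) = sz p - x by lia.
by move=> /(_ ltac:(lia)); rewrite -/(sz p); lia.
Qed.

(** Let [Y] be the total size of the rows [q] to [p]; the competitors are the shares up to [sz p]
    and those from [Y] on. When the elements cannot complete the rows of [U] up to [p], the empty
    share wins; when [z] is large, these [Y] letters are all taken and [opt_best_far] settles the
    rest; in between both families obey one bound. *)
Lemma opt_best p q z : z < cum sz p -> exists y, [/\ y <= z,
  forall k x, x <= z -> beats p q z k y x & y = 0 \/ cum sz p <= y + cum sz q].
Proof.
elim: p z => [|p IH] z zp; first by rewrite cum0 in zp.
have [pq|qp] := leqP p.+1 q.
  have [y yz best] := opt_best_far pq zp; exists y; split=> //; right.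
  by have := leq_cum sz pq; lia.
have TS k x : x <= sz p -> T k (cum sz p.+1 - x) = T k (cum sz p) + G k (sz p - x).
  move=> xS; have -> : cum sz p.+1 - x = cum sz p + (sz p - x) by rewrite cS; lia.
  by rewrite T_chunk ?leq_subr.
have qS := leq_cum sz (ltnW qp).
(* Beyond the first row [sz p], the induction hypothesis leaves two cases. *)
have mid k x : sz p <= x <= z -> beats p.+1 q z k (sz p) x \/
    exists2 y, cum sz p.+1 - cum sz q <= y <= z & beats p.+1 q z k y x.
  move=> /andP[Sx xz]; have [y1 [y1z best dich]] := IH (z - sz p) ltac:(rewrite cS in zp; lia).
  have lift : beats p.+1 q z k (sz p + y1) x.
    have -> : x = sz p + (x - sz p) by lia.
    by apply: (@beats_shift _ _ _ _ _ _ _ _ _ p); [rewrite cS; lia | lia | rewrite cS; lia | apply: best; lia].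
  case: dich lift => [->|h]; first by rewrite addn0; left.
  by right; exists (sz p + y1) => //; rewrite cS; lia.
have c0 : cum s 0 = 0 := cum0 s.
have eQ : cum sz q = cum sz q.-1 + cum s q.
  by case: (q) => [|r] /=; rewrite ?cum0 // cS.
have USu : cum U p.+1 = cum u p.+1 + cum sz p by rewrite cum_U.
have eUq := cum_U q.
have qp1 : cum sz q <= cum sz p by apply: leq_cum.
have [zT|Tz] := ltnP (cum U q + z) (cum U p.+1).
  have zY : z < cum sz p.+1 - cum sz q by have := cum_US (ltnW qp); lia.
  exists 0; split=> //; last by left.
  move=> k x xz; have lo y : y <= z -> y <= sz p -> beats p.+1 q z k 0 y.
    move=> yz yS; rewrite /beats TS // TS // !subn0.
    have := @opt_prefix k p q (cum U q + z - y) y ltac:(lia) ltac:(lia) yS.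
    by rewrite subnK; last lia; lia.
  have [xS|Sx] := leqP x (sz p); first exact: lo.
  have [h|[y yY _]] := mid k x ltac:(lia); last by lia.
  by apply: beats_trans (lo _ _ _) h; lia.
have [Y eY] : exists Y, Y + cum sz q = cum sz p.+1.
  by exists (cum sz p.+1 - cum sz q); rewrite subnK.
have cSp := cS p.
have SY : sz p <= Y by lia.
have full k x : x <= z -> exists A B, [/\ A + B = cum U q + z - x, step_valid A B,
    e' k (cum U q + z - x) = P k A + E k B & cum sz q.-1 <= A /\ cum u q <= B].
  by move=> xz; apply: opt_full; lia.
have ge_q k B : cum u q <= B -> P k (cum sz q.-1) + E k B <= e' k (cum sz q.-1 + B).
  by move=> h; apply: opt_ge; apply: valid_row.
have [zY|Yz] := ltnP z (Y + cum s q); last first.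
  have [y yz best] := @opt_best_far q q (z - Y) (leqnn _) ltac:(lia).
  have lift k x : Y <= x <= z -> beats p.+1 q z k (Y + y) x.
    move=> /andP[Yx xz]; have -> : x = Y + (x - Y) by lia.
    apply: (@beats_shift _ _ _ _ _ _ _ _ _ q); try lia.
    by apply: best; lia.
  exists (Y + y); split; [lia | move=> k x xz | right; lia].
  suff lo w : w <= z -> w <= sz p -> exists2 v, Y <= v <= z & beats p.+1 q z k v w.
    have [xS|Sx] := leqP x (sz p).
      have [v vz bv] := lo x xz xS; exact: beats_trans (lift _ _ vz) bv.
    have [bx|[v vz bx]] := mid k x ltac:(lia).
      have [v vz bv] := lo (sz p) ltac:(lia) (leqnn _).
      exact: beats_trans (lift _ _ vz) (beats_trans bv bx).
    by apply: beats_trans (lift k v _) bx; lia.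
  move=> wz wS; have [A [B [AB v eAB [Aq Bq]]]] := full k w wz.
  have [AwS|SAw] := leqP (A + w) (cum sz p.+1).
    exists (Y + cum s q); first by lia.
    rewrite /beats eAB; have -> : cum sz p.+1 - (Y + cum s q) = cum sz q.-1 by lia.
    have := ge_q k (cum u q + (z - (Y + cum s q))) (leq_addr _ _).
    have -> : cum sz q.-1 + (cum u q + (z - (Y + cum s q))) = cum U q + z - (Y + cum s q) by lia.
    have := raw_window k (cum u q + (z - (Y + cum s q))) (cum sz p.+1 - w - A).
    have -> : cum u q + (z - (Y + cum s q)) + (cum sz p.+1 - w - A) = B.
      by lia.
    have := @bot_add_top sz (G k) S_gt0 (gam_good k) A (cum sz p.+1 - w - A).
    have -> : A + (cum sz p.+1 - w - A) = cum sz p.+1 - w by lia.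
    by rewrite   P_T; lia.
  exists Y; first by lia.
  rewrite /beats eAB; have -> : cum sz p.+1 - Y = cum sz q by lia.
  have v' : step_valid (A + w - Y) B by apply: valid_sub v; lia.
  have := opt_ge k v'; have -> : A + w - Y + B = cum U q + z - Y by lia.
  have := @bot_window_top sz (G k) S_gt0 S_homo (gam_good k) q (A + w - Y) (cum sz p.+1 - w).
  have -> : A + w - Y + (cum sz p.+1 - w - cum sz q) = A by lia.
  by move=> h; have := h ltac:(lia) ltac:(rewrite cS; lia); lia.
(* All the competitors with the rows up to [p] filled are sets missing the
   first elements of a single row: this is the optimization problem one level
   below. *)
have uq : cum u q <= cum u p.+1 by apply: leq_cum; lia.
have [z1 zz1] : exists z1, z = z1 + (cum sz p - cum sz q.-1).
  by exists (z - (cum sz p - cum sz q.-1)); lia.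
have z1p : z1 < sz p by lia.
have z1q : cum u p.+1 <= cum u q + z1 by lia.
have [y [yz best dich]] := @raw_best p.+1 q z1 z1p.
pose R k := E k (cum u q + z1 - y).
have bestR k v B : v <= sz p -> sz p - v <= z1 -> B = cum u q + z1 - (sz p - v) ->
    G k (sz p - y) + E k B <= G k v + R k.
  move=> vS vz eB; have := best k (sz p - v) vz; rewrite -eB /R.
  by have -> : cum s p.+1 - (sz p - v) = v by [rewrite -/(sz p); lia]; rewrite -/(sz p).
(* Both families get the same bound for [e'] minus [T], namely [R k - G k (sz p - y)], because [P]
   and [T] agree on complete rows; the small shares outside the scope of [low] lose to 0 in [low0].
   It remains to attain the bound. *)
have low k x A B : x <= z -> x <= sz p -> A + B = cum U q + z - x -> cum u q <= B ->
    cum sz p <= A + x ->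
    P k A + E k B + G k (sz p) + G k (sz p - y) <= P k (cum sz p.+1) + G k (sz p - x) + R k.
  move=> xz xS AB Bq SA; have AS : A + x <= cum sz p.+1 by lia.
  have := @bot_fill sz (G k) S_gt0 S_homo (gam_good k) p A x xS AS.
  have := @P_row k p (A + x - cum sz p) ltac:(rewrite cS in AS; lia); rewrite subnKC // -P_rowS.
  have := @bestR k (sz p - (A + x - cum sz p)) B (leq_subr _ _).
  by rewrite cS in AS => h; have := h ltac:(lia) ltac:(lia); lia.
have low0 k x : x <= z -> x <= sz p -> beats p.+1 q z k 0 x \/
    e' k (cum U q + z - x) + G k (sz p) + G k (sz p - y) <=
    P k (cum sz p.+1) + G k (sz p - x) + R k.
  move=> xz xS; have [A [B [AB v eAB [Aq Bq]]]] := full k x xz.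
  have [SA|AS] := leqP (cum sz p) (A + x); first by right; rewrite eAB; apply: low.
  left; rewrite /beats TS // TS // !subn0 eAB.
  have v' : step_valid (A + x) B.
    apply: (@valid_sub (cum sz p.+1.-1)) => /=; first exact: ltnW.
    by apply: (@valid_row p.+1); lia.
  have := opt_ge k v'; have -> : A + x + B = cum U q + z by lia.
  have := @bot_fill sz (G k) S_gt0 S_homo (gam_good k) p A x xS ltac:(rewrite cS; lia).
  by lia.
have low_0 k : e' k (cum U q + z) + G k (sz p - y) <= P k (cum sz p.+1) + R k.
  have [A [B [AB v eAB [/= Ap Bp]]]] := @opt_full k p.+1 (cum U q + z) Tz.
  have := @low k 0 A B; rewrite !subn0 addn0 => h.
  have Bq : cum u q <= B by apply: leq_trans Bp; apply: leq_cum; lia.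
  by have := h ltac:(lia) ltac:(lia) ltac:(lia) Bq Ap; rewrite eAB; lia.
have high k x : Y <= x -> x <= z ->
    e' k (cum U q + z - x) + G k (sz p - y) <=
    P k (cum sz q.-1) + G k (cum s q - (x - Y)) + R k /\
    T k (cum sz p.+1 - x) = T k (cum sz q.-1) + G k (cum s q - (x - Y)).
  move=> Yx xz; have [A [B [AB v -> [Aq Bq]]]] := full k x xz.
  have q0 : 0 < q by case: (q) c0 zY xz Yx => // c0 zY; rewrite c0 in zY; lia.
  have eq1 : q.-1.+1 = q by rewrite prednK.
  have Sq : sz q.-1 = cum s q by rewrite /step_size eq1.
  have aS : A - cum sz q.-1 <= sz q.-1 by rewrite Sq; lia.
  split; last first.
    have -> : cum sz p.+1 - x = cum sz q.-1 + (cum s q - (x - Y)) by lia.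
    by rewrite T_chunk // Sq leq_subr.
  have := P_row k aS; rewrite subnKC // Sq.
  set a := A - cum sz q.-1; set c := cum s q.
  have csp : c <= sz p by apply: leq_cum; lia.
  have := @bestR k (c - (x - Y + a)) B ltac:(lia).
  move=> h; have {h} := h ltac:(lia).
  move=> h; have {h} := h ltac:(lia).
  have := good_pre (gam_good k) (d := q.-1) (x := c - (x - Y + a)) (t := a).
  rewrite Sq -/c => h; have {h} := h ltac:(rewrite /a /c; lia).
  have -> : c - (x - Y + a) + a = c - (x - Y) by rewrite /a /c; lia.
  by lia.
have eSp k : P k (cum sz p.+1) = P k (cum sz p) + G k (sz p) by rewrite P_rowS.
have close k w : (forall x, x <= z -> x <= sz p -> beats p.+1 q z k w x) ->
    (forall x, Y <= x -> x <= z -> beats p.+1 q z k w x) ->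
    forall x, x <= z -> beats p.+1 q z k w x.
  move=> lo hi x xz; have [xS|Sx] := leqP x (sz p); first exact: lo.
  have [bx|[v vz bx]] := mid k x ltac:(lia).
    by apply: beats_trans (lo _ _ (leqnn _)) bx; lia.
  by apply: beats_trans (hi v _ _) bx; lia.
case: dich => [y0|yq].
  exists 0; split=> //; last by left.
  have ge0 k : P k (cum sz p) + R k <= e' k (cum U q + z).
    have v : step_valid (cum sz p.+1.-1) (cum u q + z1) by apply: valid_row.
    have := opt_ge k v; rewrite /R y0 subn0 /=.
    by have -> : cum sz p + (cum u q + z1) = cum U q + z by lia.
  rewrite y0 subn0 in low0 high => k; apply: close => x.
    move=> xz xS; case: (low0 k x xz xS) => // h; rewrite /beats TS // TS // !subn0.
    by have := ge0 k; have := eSp k; lia.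
  move=> Yx xz; have [h1 h2] := high k x Yx xz; rewrite /beats h2 TS // !subn0.
  by have := ge0 k; have := P_T k p; have := P_T k q.-1; lia.
have vq : sz p - y <= cum s q by rewrite /step_size; lia.
(* The share [w] leaves [cum sz q.-1 + (sz p - y)] letters, which is the form needed to attain the
   bound; by the alternative [yq] the second summand fits into row [q.-1]. *)
have [w ew] : exists w, w = Y + (cum s q - (sz p - y)) by eexists.
have wz : w <= z by lia.
have geM k : P k (cum sz q.-1) + R k <= e' k (cum U q + z - w).
  have := ge_q k (cum u q + z1 - y) ltac:(lia).
  suff -> : cum sz q.-1 + (cum u q + z1 - y) = cum U q + z - w by [].
  by lia.
have q0 : 0 < q.
  by case: (q) c0 vq => // c0; rewrite c0; rewrite /step_size in z1p *; lia.
have Tw k : T k (cum sz p.+1 - w) = T k (cum sz q.-1) + G k (sz p - y).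
  have -> : cum sz p.+1 - w = cum sz q.-1 + (sz p - y) by lia.
  by rewrite T_chunk // /step_size prednK.
exists w; split=> //; last by right; lia.
have beat0 k : beats p.+1 q z k w 0.
  rewrite /beats Tw TS // !subn0; have := low_0 k; have := geM k.
  by have := P_T k p; have := P_T k q.-1; have := eSp k; lia.
move=> k; apply: close => x.
  move=> xz xS; case: (low0 k x xz xS) => [h|h]; first exact: beats_trans (beat0 k) h.
  rewrite /beats Tw TS //.
  by have := geM k; have := P_T k p; have := P_T k q.-1; have := eSp k; lia.
move=> Yx xz; have [h1 h2] := high k x Yx xz; rewrite /beats h2 Tw.
by have := geM k; have := P_T k q.-1; lia.
Qed.

Lemma step_system : system sz G U e'.
Proof.
split.
- exact: S_gt0.
- by rewrite /step_size cumS cum0 (sys_size0 sys).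
- exact: S_homo.
- exact: gam_good.
- by move=> i; rewrite /step_row leq_add ?u_homo ?leq_cum.
- exact: U_le.
- exact: opt_window.
- exact: opt_remove.
- exact: opt_row.
- exact: opt_complete.
- exact: opt_best.
Qed.

(** With [cum U q <= C < cum U q.+1], the split is forced while row [q] of [U'] cannot be completed.
    Beyond that the surplus [z] is shared between one row of the multiples and the rows of [U']
    after row [q], and [raw_best] gives a share independent of [k]. *)
Lemma opt_uniform C : exists A B, [/\ A + B = C, step_valid A B,
  forall k, e' k C = P k A + E k B &
  forall q, cum U q <= C -> cum sz q.-1 <= A /\ cum u q <= B].
Proof.
have U0 : 0 < U 1 by rewrite /step_row cumS (sys_size0 sys); lia.
have [q /andP[qC Cq]] : exists q, cum U q <= C < cum U q.+1.
  have : exists q, C < cum U q.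
    exists C.+2; elim: (C) => [|n IH]; first by rewrite !cumS; lia.
    rewrite cumS; suff : 0 < U n.+2 by lia.
    rewrite /step_row; have := @leq_cum s 1 n.+2; rewrite [cum s 1]cumS cum0 (sys_size0 sys); lia.
  case/ex_minnP=> [[|q]]; first by rewrite cum0.
  by move=> h hm; exists q; rewrite h andbT leqNgt; apply/negP => /hm; rewrite ltnn.
suff [A [B [AB v eAB Aq Bq]]] : exists A B, [/\ A + B = C, step_valid A B,
    forall k, e' k C = P k A + E k B, cum sz q.-1 <= A & cum u q <= B].
  exists A, B; split=> // r rC; have rq : r <= q.
    by rewrite leqNgt; apply/negP => h; have := @leq_cum U _ _ h; lia.
  by split; [apply: leq_trans Aq | apply: leq_trans Bq]; apply: leq_cum; lia.
have full k : exists A B, [/\ A + B = C, step_valid A B, e' k C = P k A + E k B &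
    [/\ cum sz q.-1 <= A, cum u q <= B & A = cum sz q.-1 \/ cum u q.+1 <= B]].
  have [A [B [AB v eAB [Aq Bq]]]] := opt_full k qC; exists A, B; split=> //; split=> //.
  have [->|nA] := eqVneq A (cum sz q.-1); first by left.
  right; have /(validP _ _ v) : cum sz q.-1 < A by lia.
  by apply: leq_trans; apply: leq_cum; lia.
have eUq := cum_U q; have eu := cumS u q.
have [Cu|uC] := ltnP C (cum U q + u q).
  have v : step_valid (cum sz q.-1) (C - cum sz q.-1) by apply: valid_row; lia.
  exists (cum sz q.-1), (C - cum sz q.-1); split=> //; try lia.
  move=> k; have [A [B [AB _ -> [Aq Bq AB']]]] := full k.
  by have -> : A = cum sz q.-1 by [lia]; have -> : B = C - cum sz q.-1 by lia.
have eU : U q = u q + cum s q by [].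
have [z ez] : exists z, C = cum U q + u q + z by exists (C - (cum U q + u q)); rewrite subnKC.
have zq : z < cum s q by move: Cq; rewrite cumS; lia.
have [y [yz best _]] := @raw_best q q.+1 z zq.
have q0 : 0 < q by case: (q) zq => //; rewrite cum0.
have Sq : sz q.-1 = cum s q by rewrite /step_size prednK.
have PE k a : a <= z -> P k (cum sz q.-1 + a) + G k (cum s q - a) = P k (cum sz q.-1) + G k (cum s q).
  by move=> az; rewrite -Sq P_row // Sq; lia.
have v : step_valid (cum sz q.-1 + y) (cum u q.+1 + z - y).
  apply: (@valid_sub (cum sz q)); last by apply: (@valid_row q.+1); lia.
  by rewrite -{2}(prednK q0) cS Sq; lia.
exists (cum sz q.-1 + y), (cum u q.+1 + z - y); split=> //; try lia.
move=> k; apply/eqP; rewrite eqn_leq; apply/andP; split; last first.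
  by have := opt_ge k v; rewrite (_ : cum sz q.-1 + y + (cum u q.+1 + z - y) = C) //; lia.
have [A [B [AB _ -> [Aq Bq AB']]]] := full k.
have az : A - cum sz q.-1 <= z by lia.
have := PE k _ az; rewrite subnKC //; have := PE k y yz.
have := best k _ az; rewrite (_ : cum u q.+1 + z - (A - cum sz q.-1) = B); first lia.
by lia.
Qed.

End Step.

(** * Monomials as sequences of exponents *)

(* Index [m] stands for polynomial rings in [m.+1] variables. *)
Fixpoint nmon m := if m is m'.+1 then step_size (nmon m') else fun _ => 1.

Fixpoint mlab m := if m is m'.+1 then step_lab (nmon m') (mlab m') else fun _ => minn 1.

(* For [u0 = b :: l], [urow l d] is the number of monomials [v] of degree
   [b + d] with [u0 <= v] in the lexicographic order. *)
Fixpoint urow l :=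
  if l is b :: l' then step_row (nmon (size l')) (urow l') b else fun _ => 1.

(** In one variable every monomial has the label, for all [k]. *)
Fixpoint uopt l :=
  if l is b :: l' then step_opt (nmon (size l')) (mlab (size l')) (urow l') (uopt l') b
  else fun _ C => C.

Lemma sum_ones n : cum (fun _ => 1) n = n.
Proof. by rewrite /cum sum_nat_const card_ord muln1. Qed.

Lemma level_system l : system (nmon (size l)) (mlab (size l)) (urow l) (uopt l).
Proof.
elim: l => [|b l IH] /=; last exact: step_system.
have g1 : good (fun _ => 1) (minn 1) by split=> //= *; lia.
have topid t : top (fun _ => 1) (minn 1) t = t.
  elim: t => [|t IH]; first by rewrite top0.
  by rewrite -{1}(sum_ones t.+1) topS // sum_ones IH addn1.
split=> //=.
- by move=> k B t; rewrite topid.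
- by move=> k q C t _ t1; lia.
- by move=> k q; rewrite !sum_ones addn1.
- move=> k q w w1; exists w => //; rewrite !sum_ones; lia.
- move=> p q z; rewrite sum_ones => zp; exists 0; split=> //; last by left.
  by move=> k x xz; rewrite !topid sum_ones; lia.
Qed.

Lemma level_nseq m :
  system (nmon m) (mlab m) (urow (nseq m 0)) (uopt (nseq m 0)).
Proof. by have := level_system (nseq m 0); rewrite size_nseq. Qed.

(** [h d] elements are kept in row [d]. Since the higher rows are cut first, at least [cum u n.+1]
    elements remain when row [n] is treated, as [sys_remove] requires. *)
Lemma uopt_ge l b k (h : nat -> nat) D :
  (forall d, h d <= shift_row b (urow l) d) ->
  \sum_(d < D) mlab (size l) k (shift_row b (urow l) d) <=
  \sum_(d < D) mlab (size l) k (shift_row b (urow l) d - h d) +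
  uopt l k (\sum_(d < D) h d).
Proof.
have sys := level_system l.
have := raw_remove (b := b) sys k; have := raw_row b sys k; rewrite /=.
move: (shift_row b (urow l)) => u row remove hu.
have eD : \sum_(d < D) mlab (size l) k (u d) + uopt l k 0 = uopt l k (cum u D).
  elim: D => [|D IH]; first by rewrite big_ord0 cum0.
  by rewrite big_ord_recr /= addnAC IH row.
apply: leq_trans (leq_addr (uopt l k 0) _) _; rewrite eD => {eD}.
suff H n E : n <= D -> E = \sum_(d < D | n <= d) (u d - h d) ->
    uopt l k (cum u D) <= \sum_(d < D | n <= d) mlab (size l) k (u d - h d)
      + uopt l k (cum u D - E).
  have := H 0 _ (leq0n _) (erefl _).
  have -> : cum u D - \sum_(d < D | 0 <= d) (u d - h d) = \sum_(d < D) h d.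
    apply/eqP; rewrite -(eqn_add2r (\sum_(d < D | 0 <= d) (u d - h d))) subnK.
      by rewrite -big_split /=; apply/eqP; apply: eq_bigr => i _; rewrite subnKC.
    by apply: leq_sum => i _; apply: leq_subr.
  by [].
elim: {n}(D - n) {-2}n (erefl (D - n)) E => [|j IH] n nj E nD eE.
  have en : n = D by lia.
  have big0 (F : nat -> nat) : \sum_(d < D | n <= d) F d = 0.
    by apply: big1 => i; rewrite en leqNgt ltn_ord.
  rewrite eE (big0 (fun d => u d - h d)) (big0 (fun d => mlab (size l) k (u d - h d))).
  by rewrite subn0.
have nD' : n < D by lia.
have split1 (F : nat -> nat) :
    \sum_(d < D | n <= d) F d = F n + \sum_(d < D | n.+1 <= d) F d.
  rewrite (bigD1 (Ordinal nD')) //=; congr (_ + _); apply: eq_bigl => i.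
  by rewrite -val_eqE /= ltn_neqAle andbC eq_sym.
have := IH n.+1 ltac:(lia) _ nD' (erefl _).
rewrite eE (split1 (fun d => u d - h d)) (split1 (fun d => mlab (size l) k (u d - h d))).
set E1 := \sum_(d < D | n.+1 <= d) (u d - h d) => h1.
have E1le : E1 + cum u n.+1 <= cum u D.
  have -> : cum u D = \sum_(d < D | n.+1 <= d) u d + \sum_(d < D | ~~ (n.+1 <= d)) u d.
    by rewrite /cum (bigID (fun d : 'I_D => n.+1 <= d)).
  apply: leq_add; first by apply: leq_sum => i _; apply: leq_subr.
  rewrite /cum (big_ord_widen _ _ nD') /= leq_eqVlt; apply/orP; left; apply/eqP.
  by apply: eq_bigl => i; rewrite -leqNgt ltnS.
have h2 := remove n (cum u D - E1) (u n - h n) ltac:(lia) (leq_subr _ _).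
have -> : cum u D - (u n - h n + E1) = cum u D - E1 - (u n - h n) by lia.
by lia.
Qed.

(** * Lists of the monomials of one degree *)

Lemma big_iota (F : nat -> nat) n : \sum_(j <- iota 0 n) F j = \sum_(j < n) F j.
Proof. by rewrite -[in LHS](subn0 n) -/(index_iota 0 n) big_mkord. Qed.

(** Decreasing lex order: block [i] has first exponent [d - i], so the blocks are the rows 0 to [d]
    of the ring without the first variable, in the order in which [top] fills them. *)
Fixpoint mons m d : seq (seq nat) :=
  if m is m'.+1 then flatten [seq [seq (d - i) :: w | w <- mons m' i] | i <- iota 0 d.+1]
  else [:: [:: d]].

Lemma monsS m d :
  mons m.+1 d = flatten [seq [seq (d - i) :: w | w <- mons m i] | i <- iota 0 d.+1].
Proof. by []. Qed.

Fixpoint slt (u v : seq nat) :=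
  match u, v with
  | x :: u', y :: v' => (x < y) || ((x == y) && slt u' v')
  | _, _ => false
  end.

Definition is_mon m d (w : seq nat) := (size w == m.+1) && (sumn w == d).

Lemma slt_trans : transitive slt.
Proof.
move=> v; elim: v => [|y v IH] [|x u] [|z w] //=.
case/orP=> [xy|/andP[/eqP -> uv]]; case/orP=> [yz|/andP[/eqP <- vw]].
- by rewrite (ltn_trans xy yz).
- by rewrite xy.
- by rewrite yz.
- by rewrite eqxx (IH _ _ uv vw) orbT.
Qed.

Lemma slt_irr u : slt u u = false.
Proof. by elim: u => //= x u ->; rewrite ltnn andbF. Qed.

Lemma slt_total u v : size u = size v -> ~~ slt u v -> ~~ slt v u -> u = v.
Proof.
elim: u v => [|x u IH] [|y v] //= [suv].
rewrite !negb_or => /andP[xy uv] /andP[yx vu].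
have exy : x = y by lia.
by move: uv vu; rewrite exy eqxx /= => uv vu; congr (_ :: _); apply: IH.
Qed.

Lemma slt_asym u v : slt u v -> slt v u -> False.
Proof. by move=> uv /(slt_trans uv); rewrite slt_irr. Qed.

Lemma mem_mons m d w : (w \in mons m d) = is_mon m d w.
Proof.
elim: m d w => [|m IH] d w.
  by rewrite inE /is_mon; case: w => [|x [|y w]] //=; rewrite !eqseq_cons ?andbT ?andbF ?addn0.
rewrite monsS; apply/flatten_mapP/idP => [[i]|].
  rewrite mem_iota add0n => /andP[_ id] /mapP[w' + ->].
  by rewrite IH /is_mon /= => /andP[/eqP -> /eqP ->]; rewrite subnK ?eqxx //; lia.
rewrite /is_mon; case: w => [|x w] // /andP[sw /eqP dw].
exists (sumn w); first by rewrite mem_iota -dw /=; lia.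
apply/mapP; exists w; first by rewrite IH /is_mon -eqSS eqxx andbT.
by congr (_ :: _); rewrite -dw /=; lia.
Qed.

Lemma size_mons m d : size (mons m d) = nmon m d.
Proof.
elim: m d => [|m IH] d //.
rewrite monsS size_flatten /shape -map_comp (eq_map (g := nmon m)); last first.
  by move=> i /=; rewrite size_map IH.
by rewrite sumnE big_map big_iota.
Qed.

Lemma sorted_mons m d : sorted (fun u v => slt v u) (mons m d).
Proof.
have tr : transitive (fun u v => slt v u) by move=> v u w uv vw; apply: slt_trans vw uv.
elim: m d => [|m IH] d //.
have blocks n i0 : i0 + n <= d.+1 ->
    sorted (fun u v => slt v u) (flatten [seq [seq (d - i) :: w | w <- mons m i] | i <- iota i0 n]).
  elim: n i0 => [|n IHn] i0 // h /=.
  rewrite sorted_pairwise // pairwise_cat -!sorted_pairwise // IHn ?andbT; last by lia.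
  apply/andP; split; last first.
    rewrite sorted_map; apply: sub_sorted (IH i0) => u v /= ->.
    by rewrite eqxx orbT.
  apply/allrelP => u v /mapP[u' _ ->] /flatten_mapP[i]; rewrite mem_iota => hi.
  by case/mapP=> v' _ -> /=; apply/orP; left; lia.
exact: blocks.
Qed.

Lemma uniq_mons m d : uniq (mons m d).
Proof.
apply: sorted_uniq (sorted_mons m d); last by move=> u; apply: slt_irr.
by move=> v u w uv vw; apply: slt_trans vw uv.
Qed.

Definition low k (w : seq nat) := all (pred1 0) (drop k.+1 w).

Lemma sumn_eq0 w : (sumn w == 0) = all (pred1 0) w.
Proof. by elim: w => //= x w IH; rewrite addn_eq0 IH. Qed.

Lemma take_flatten (T : Type) (F : nat -> seq T) i n x : i < n -> x <= size (F i) ->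
  take (\sum_(j < i) size (F j) + x) (flatten [seq F j | j <- iota 0 n]) =
  flatten [seq F j | j <- iota 0 i] ++ take x (F i).
Proof.
move=> ilt xi; have -> : n = i + (n - i.+1).+1 by lia.
rewrite iotaD map_cat flatten_cat add0n /= take_cat.
have -> : size (flatten [seq F j | j <- iota 0 i]) = \sum_(j < i) size (F j).
  by rewrite size_flatten /shape -map_comp sumnE big_map big_iota.
by rewrite ltnNge leq_addr /= addKn takel_cat.
Qed.

(** This identifies the recursive label functions with counts of monomials. For [k = 0] only the
    pure power of the first variable counts, and it heads the list. *)
Lemma count_low_take m d k t : t <= nmon m d ->
  count (low k) (take t (mons m d)) = mlab m k t.
Proof.
elim: m d k t => [|m IH] d k t.
  by case: t => [|[|t]] //= _; rewrite /low /= minn0.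
case: k => [|k] tS.
  rewrite [mlab _ _ _]/= [mons _ _]/= take_cat size_map size_mons.
  have := @mem_mons m 0 (nseq m.+1 0).
  rewrite /is_mon size_nseq sumn_nseq mul0n !eqxx /=.
  have s0 := sys_size0 (level_nseq m).
  have := size_mons m 0; rewrite s0.
  case: (mons m 0) => [|z [|z' r]] //= _; rewrite inE => /eqP <-.
  case: t {tS} => [|t] //=.
  have -> : low 0 [:: d - 0, 0 & nseq m 0] by rewrite /low /= all_nseq orbT.
  rewrite subn1 /=.
  suff -> : count (low 0) (take t (flatten [seq [seq (d - i) :: w | w <- mons m i] | i <- iota 1 d])) = 0.
    by lia.
  apply/eqP; rewrite -leqn0 leqNgt -has_count; apply/hasPn => w /mem_take /flatten_mapP[i].
  rewrite mem_iota => hi /mapP[w' + ->]; rewrite mem_mons /is_mon /low /= drop0 => /andP[_ sw].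
  by rewrite -sumn_eq0 (eqP sw); lia.
have s0 := sys_pos (level_nseq m).
have [->|t_gt0] := posnP t; first by rewrite take0 /= top0.
have [i [x [et xi]]] := cumP t.-1 s0.
have {}et : t = cum (nmon m) i + x.+1 by lia.
have id : i <= d.
  rewrite leqNgt; apply/negP => h; have := leq_cum (nmon m) h.
  by move: tS; rewrite /= /step_size; lia.
have L0 k' : mlab m k' 0 = 0.
  exact: good0 (sys_good (level_nseq m) k').
have eF j : size [seq (d - j) :: w | w <- mons m j] = nmon m j by rewrite size_map size_mons.
rewrite monsS [mlab _ _ _]/= et /top row_fillE //.
have -> : cum (nmon m) i = \sum_(j < i) size [seq (d - j) :: w | w <- mons m j].
  by apply: eq_bigr => j _; rewrite eF.
rewrite (@take_flatten _ (fun j => [seq d - j :: w | w <- mons m j]) i d.+1 x.+1) ?eF //.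
have ecount s c : count (low k.+1) [seq c :: w | w <- s] = count (low k) s.
  by rewrite count_map.
rewrite count_cat count_flatten -!map_comp sumnE big_map -map_take ecount IH // big_iota; congr (_ + _).
by apply: eq_bigr => j _ /=; rewrite ecount -{1}(take_size (mons m j)) size_mons IH.
Qed.

Lemma filter_sorted_up (T : eqType) (r : rel T) (Q : pred T) s : transitive r ->
  sorted r s -> {in s &, forall x y, r x y -> Q y -> Q x} ->
  filter Q s = take (count Q s) s.
Proof.
move=> tr; elim: s => //= x s IH rs up.
have rs' := path_sorted rs; move: rs; rewrite path_sortedE // => /andP[/allP rx _].
have up' : {in s &, forall x y, r x y -> Q y -> Q x}.
  by move=> y z ys zs; apply: up; rewrite inE ?ys ?zs orbT.
case: ifP => Qx; first by rewrite /= -IH.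
have nQ : count Q s = 0.
  apply/eqP; rewrite -leqn0 leqNgt -has_count; apply/hasPn => y ys.
  apply/negP => Qy; have := up x y; rewrite !inE eqxx ys orbT Qx.
  by move=> /(_ isT isT (rx y ys) Qy).
by rewrite nQ IH // nQ take0.
Qed.

(** The blocks with [i < d - b] lie entirely above the bound, those with [i > d - b] entirely below;
    the block [i = d - b] is the same problem in one variable less. *)
Lemma count_up b l d :
  count (fun w => ~~ slt w (b :: l)) (mons (size l) d) = shift_row b (urow l) d.
Proof.
elim: l b d => [|b' l IH] b d.
  by rewrite /shift_row /= andbF orbF; case: ltnP.
rewrite [size _]/= monsS count_flatten -map_comp sumnE big_map.
pose F i := count (fun w => ~~ slt ((d - i) :: w) [:: b, b' & l]) (mons (size l) i).
rewrite (eq_bigr F); last by move=> i _; rewrite /F /= count_map.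
rewrite big_iota -(big_mkord xpredT F) /shift_row.
case: ltnP => db.
  apply: big1 => i _; apply/eqP; rewrite -leqn0 leqNgt -has_count.
  by apply/hasPn => w _ /=; rewrite negbK; apply/orP; left; lia.
rewrite (@big_cat_nat _ _ _ (d - b)) //=; last by lia.
rewrite (@big_ltn _ _ _ (d - b)); last by lia.
have -> : \sum_((d - b).+1 <= i < d.+1) F i = 0.
  rewrite big_nat_cond; apply: big1 => i /andP[/andP[h1 h2] _].
  apply/eqP; rewrite -leqn0 leqNgt -has_count.
  by apply/hasPn => w _ /=; rewrite negbK; apply/orP; left; lia.
rewrite addn0 addnC /step_row; congr (_ + _).
  rewrite -IH /F; apply: eq_count => w /=.
  have -> : d - (d - b) = b by lia.
  by rewrite ltnn eqxx.
rewrite big_mkord; apply: eq_bigr => i _; rewrite -size_mons -[RHS]count_predT.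
apply: eq_count => w /=; have := ltn_ord i => h.
by rewrite negb_or negb_and; apply/andP; split; [|apply/orP; left]; lia.
Qed.

Lemma count_split (T : Type) (a p : pred T) s :
  count a s = count (fun x => a x && p x) s + count (fun x => a x && ~~ p x) s.
Proof. by elim: s => //= x s ->; case: (a x); case: (p x) => /=; lia. Qed.

Lemma count_by_degree (P : pred (seq nat)) (M : seq (seq nat)) D :
  (forall w, w \in M -> sumn w < D) ->
  count P M = \sum_(d < D) count (fun w => P w && (sumn w == d)) M.
Proof.
elim: M => [|x M IH] MD /=; first by rewrite big1.
rewrite big_split /= IH; last by move=> w wM; apply: MD; rewrite inE wM orbT.
congr (_ + _); have xD := MD x (mem_head _ _).
rewrite (bigD1 (Ordinal xD)) //= eqxx andbT big1 ?addn0 // => i.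
by rewrite -val_eqE /= eq_sym => /negbTE ->; rewrite andbF.
Qed.

Lemma degree_bound (M : seq (seq nat)) : exists D, forall w, w \in M -> sumn w < D.
Proof.
elim: M => [|x M [D MD]]; first by exists 0.
exists (maxn D (sumn x).+1) => w; rewrite inE => /orP[/eqP ->|/MD]; lia.
Qed.

(** * Lower lex segments of an upper set *)

Section Segments.
Variables (b : nat) (l : seq nat) (M : seq (seq nat)).
Let m := size l.
Let Q w := ~~ slt w (b :: l).
Hypothesis uniqM : uniq M.
Hypothesis subM : forall w, w \in M -> size w = m.+1 /\ Q w.
Hypothesis lowM : forall u v, u \in M -> size v = m.+1 -> Q v ->
  sumn v = sumn u -> slt v u -> v \in M.

Lemma count_degree (P : pred (seq nat)) d :
  count (fun w => P w && (sumn w == d)) M = count (fun w => P w && (w \in M)) (mons m d).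
Proof.
rewrite -!size_filter; apply: perm_size; apply: uniq_perm.
- exact: filter_uniq.
- exact: filter_uniq (uniq_mons _ _).
move=> w; rewrite !mem_filter mem_mons /is_mon; case: (P w) => //=.
have [wM|] := boolP (w \in M); last by rewrite andbF.
by have [-> _] := subM wM; rewrite eqxx andbT.
Qed.

(** In degree [d] both the upper set and its part outside [M] are upper lex segments, hence initial
    segments of [mons m d], whose labels [mlab] counts. *)
Lemma ladder_degree k d : let h := count (mem M) (mons m d) in
  let u := shift_row b (urow l) d in
  h <= u /\ count (fun w => low k w && (w \in M)) (mons m d) + mlab m k (u - h) = mlab m k u.
Proof.
move=> h u; have eu : count Q (mons m d) = u by apply: count_up.
have tr : transitive (fun u v => slt v u) by move=> y x z xy yz; apply: slt_trans yz xy.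
have upQ : {in mons m d &, forall x y, slt y x -> Q y -> Q x}.
  move=> x y xs ys yx; apply: contra => xQ; exact: slt_trans yx xQ.
pose J w := Q w && (w \notin M).
have upJ : {in mons m d &, forall x y, slt y x -> J y -> J x}.
  move=> x y; rewrite !mem_mons => /andP[sx /eqP dx] /andP[sy /eqP dy] yx /andP[Qy My].
  have Qx : Q x by move: Qy; apply: contra => xQ; exact: slt_trans yx xQ.
  rewrite /J Qx /=; apply: contra My => xM.
  by apply: lowM xM _ Qy _ yx; [apply/eqP | rewrite dx dy].
have eh P : count (fun w => (P w && Q w) && (w \in M)) (mons m d) =
    count (fun w => P w && (w \in M)) (mons m d).
  apply: eq_in_count => w _; case: (P w) => //=.
  by have [wM|] := boolP (w \in M); rewrite ?andbF // (proj2 (subM wM)).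
have uh : u = h + count J (mons m d).
  rewrite -eu (count_split _ (mem M)); congr (_ + _).
  by have := eh xpredT.
have lowE (P : pred (seq nat)) : {in mons m d &, forall x y, slt y x -> P y -> P x} ->
    count (fun w => low k w && P w) (mons m d) = mlab m k (count P (mons m d)).
  move=> upP; rewrite -(count_low_take (d := d)); last by rewrite -size_mons count_size.
  rewrite -(filter_sorted_up tr (sorted_mons m d) upP) count_filter.
  by apply: eq_count.
split; first by rewrite uh leq_addr.
have -> : u - h = count J (mons m d) by rewrite uh addKn.
rewrite -lowE // -eu -lowE // [RHS](count_split _ (mem M)).
congr (_ + _); first by rewrite -(eh (low k)).
by apply: eq_count => w; rewrite /J /= andbA.
Qed.

Lemma ladder_bound k : count (low k) M <= uopt l k (size M).
Proof.
have [D MD] := degree_bound M.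
have := @uopt_ge l b k (fun d => count (mem M) (mons m d)) D.
rewrite -/m => /(_ (fun d => proj1 (ladder_degree k d))).
have -> : \sum_(d < D) count (mem M) (mons m d) = size M.
  rewrite -count_predT (count_by_degree _ MD); apply: eq_bigr => d _.
  by have := count_degree xpredT d.
rewrite (count_by_degree _ MD); set x := uopt _ _ _; set S1 := \sum_(d < D) mlab _ _ _.
have -> : S1 = \sum_(d < D) count (fun w => low k w && (sumn w == d)) M +
    \sum_(d < D) mlab m k (shift_row b (urow l) d - count (mem M) (mons m d)).
  rewrite -big_split; apply: eq_bigr => d _ /=.
  by rewrite count_degree (proj2 (ladder_degree k d)).
by lia.
Qed.

End Segments.

Lemma all2_leq_sumn v u : all2 leq v u -> sumn v <= sumn u.
Proof. by elim: v u => [|x v IH] [|y u] //= /andP[xy /IH]; lia. Qed.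

Lemma all2_leq_eq v u : all2 leq v u -> sumn v = sumn u -> v = u.
Proof.
elim: v u => [|x v IH] [|y u] //= /andP[xy vu] e.
have := all2_leq_sumn vu => h; have exy : x = y by lia.
by rewrite exy (IH u) //; lia.
Qed.

Lemma drop_sorted_low n s u v : sorted (fun u v => slt v u) s ->
  u \in drop n s -> v \in s -> slt v u -> v \in drop n s.
Proof.
have tr : transitive (fun u v => slt v u) by move=> y x z xy yz; apply: slt_trans yz xy.
rewrite sorted_pairwise // -{1 3}(cat_take_drop n s) pairwise_cat mem_cat => /andP[/allrelP rel _].
move=> ud /orP[vt|//] vu; have := rel _ _ vt ud => uv.
by case: (slt_asym uv vu).
Qed.

(** * Optimal sets *)

(* The first [A] monomials, by degree and then from the lex-smallest one. *)
Record initial m A (I : seq (seq nat)) : Prop := Initial {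
  ini_uniq : uniq I;
  ini_size : size I = A;
  ini_sub : forall w, w \in I -> size w = m.+1 /\ cum (nmon m) (sumn w) < A;
  ini_low : forall u v, u \in I -> size v = m.+1 ->
    sumn v < sumn u \/ sumn v = sumn u /\ slt v u -> v \in I;
  ini_full : forall q w, cum (nmon m) q <= A -> size w = m.+1 -> sumn w < q -> w \in I;
  ini_count : forall k, count (low k) I = bot (nmon m) (mlab m k) A }.

Lemma initial_ex m A : exists I, initial m A I.
Proof.
have sys := level_nseq m; have s0 := sys_pos sys.
have [i [a [eA ai]]] := cumP A s0.
pose I1 := flatten [seq mons m d | d <- iota 0 i].
pose I2 := drop (nmon m i - a) (mons m i).
have memI1 w : (w \in I1) = (size w == m.+1) && (sumn w < i).
  apply/flatten_mapP/andP => [[d]|[sw wi]].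
    by rewrite mem_iota mem_mons /is_mon => hd /andP[-> /eqP ->].
  by exists (sumn w); rewrite ?mem_iota // mem_mons /is_mon sw eqxx.
have subI2 w : w \in I2 -> is_mon m i w by move/mem_drop; rewrite mem_mons.
have sI1 : size I1 = cum (nmon m) i.
  rewrite size_flatten /shape -map_comp sumnE big_map big_iota.
  by apply: eq_bigr => d _ /=; rewrite size_mons.
have sI2 : size I2 = a by rewrite size_drop size_mons; lia.
have countI1 k : count (low k) I1 = \sum_(d < i) mlab m k (nmon m d).
  rewrite count_flatten -map_comp sumnE big_map big_iota; apply: eq_bigr => d _ /=.
  by rewrite -{1}(take_size (mons m d)) size_mons count_low_take.
have L0 k : mlab m k 0 = 0 by exact: good0 (sys_good sys k).
have bA q : (cum (nmon m) q <= A) = (q <= i).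
  have [qi|iq] := leqP q i; first by have := leq_cum (nmon m) qi; lia.
  by have := leq_cum (nmon m) iq; rewrite cumS; lia.
exists (I1 ++ I2); split.
- rewrite cat_uniq (drop_uniq _ (uniq_mons m i)) andbT; apply/andP; split; last first.
    by apply/hasPn => w /subI2 /andP[_ /eqP wi]; rewrite memI1 wi ltnn andbF.
  apply: count_mem_uniq => w; rewrite memI1.
  rewrite count_flatten -map_comp sumnE big_map big_iota.
  have cnt d : count_mem w (mons m d) = is_mon m d w.
    by rewrite count_uniq_mem ?uniq_mons // mem_mons.
  case: ltnP => wi; last first.
    rewrite andbF big1 // => d _; rewrite /= cnt /is_mon.
    by have := ltn_ord d; case: eqP => //=; case: eqP => //; lia.
  rewrite (bigD1 (Ordinal wi)) //= cnt /is_mon eqxx big1 ?addn0 // => d.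
  by rewrite -val_eqE /= cnt /is_mon eq_sym => /negbTE ->; rewrite andbF.
- by rewrite size_cat sI1 sI2.
- move=> w; rewrite mem_cat memI1 => /orP[/andP[/eqP -> wi]|wI].
    by split=> //; have := leq_cum (nmon m) wi; rewrite cumS; have := s0 (sumn w); lia.
  have := subI2 w wI; rewrite /is_mon => /andP[/eqP -> /eqP ->]; split=> //.
  have : 0 < size I2 by rewrite lt0n; apply: contraTneq wI => /size0nil ->.
  by lia.
- move=> u v; rewrite !mem_cat !memI1 => /orP[/andP[_ ui]|uI] sv h.
    by rewrite sv eqxx; case: h => [|[]]; [lia | move=> ->; rewrite ui].
  have := subI2 u uI; rewrite /is_mon => /andP[_ /eqP ui].
  rewrite sv eqxx /=; case: h => [|[e vu]]; first by rewrite ui => ->.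
  apply/orP; right; apply: drop_sorted_low uI _ vu; first exact: sorted_mons.
  by rewrite mem_mons /is_mon sv e ui !eqxx.
- move=> q w; rewrite bA => qi sw wq.
  by rewrite mem_cat memI1 sw eqxx /=; apply/orP; left; lia.
- move=> k; rewrite count_cat countI1.
  have tE : top (nmon m) (mlab m k) (cum (nmon m) i) = \sum_(d < i) mlab m k (nmon m d).
    by rewrite -[cum _ _]addn0 /top row_fillE // L0 addn0.
  have := @count_low_take m i k (nmon m i - a) (leq_subr _ _).
  have := @count_low_take m i k (nmon m i) (leqnn _).
  rewrite -{1}size_mons take_size -{1}(cat_take_drop (nmon m i - a) (mons m i)) count_cat -/I2.
  have := botE s0 (sys_good sys k) (ltnW ai); rewrite -eA.
  by rewrite (bot_top s0 (sys_good sys k)) tE; lia.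
Qed.

(** [opt_low] and [opt_div] are what [low_ladder] asks for. [opt_rows] serves the recursion: it
    turns the numerical condition [step_valid] into the presence of monomials in the part without
    the new variable. *)
Record optimal b l (N : seq (seq nat)) : Prop := Optimal {
  opt_uniq : uniq N;
  opt_sub : forall w, w \in N -> size w = (size l).+1 /\ ~~ slt w (b :: l);
  opt_low : forall u v, u \in N -> size v = (size l).+1 -> ~~ slt v (b :: l) ->
    sumn v = sumn u -> slt v u -> v \in N;
  opt_div : forall u v, u \in N -> size v = (size l).+1 -> ~~ slt v (b :: l) ->
    all2 leq v u -> v \in N;
  opt_rows : forall q w, cum (shift_row b (urow l)) q <= size N ->
    size w = (size l).+1 -> ~~ slt w (b :: l) -> sumn w < q -> w \in N;
  opt_count : forall k, count (low k) N = uopt l k (size N) }.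

Lemma optimal_ex1 b c : exists2 N, optimal b [::] N & size N = c.
Proof.
exists [seq [:: b + i] | i <- iota 0 c]; last by rewrite size_map size_iota.
have memN w : size w = 1 -> ~~ slt w [:: b] -> sumn w < b + c ->
    w \in [seq [:: b + i] | i <- iota 0 c].
  case: w => [|x [|]] //= _; rewrite andbF orbF addn0 -leqNgt => bx xc.
  by apply/mapP; exists (x - b); [rewrite mem_iota; lia | rewrite subnKC].
have memN' w : w \in [seq [:: b + i] | i <- iota 0 c] ->
    exists2 i, i < c & w = [:: b + i].
  by case/mapP=> i; rewrite mem_iota => ic ->; exists i => //; lia.
split.
- by rewrite map_inj_uniq ?iota_uniq // => i j [] /addnI.
- by move=> w /memN'[i ic ->] /=; rewrite andbF orbF -leqNgt leq_addr.
- move=> u v /memN'[i ic ->] sv bv e _; apply: memN => //.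
  by rewrite e /= addn0 ltn_add2l.
- move=> u v /memN'[i ic ->] sv bv /all2_leq_sumn /= h; apply: memN => //.
  by rewrite addn0 in h; apply: leq_ltn_trans h _; rewrite ltn_add2l.
- move=> q w; rewrite cum_shift_row /= sum_ones size_map size_iota => qc sw bw wq.
  by apply: memN => //; lia.
- move=> k /=; rewrite size_map size_iota count_map -[RHS](size_iota 0) -count_predT.
  exact: eq_count.
Qed.

Definition shift_head c (w : seq nat) := (c + head 0 w) :: behead w.

Lemma optimal_ex b l c : exists2 N, optimal b l N & size N = c.
Proof.
elim: l b c => [|b2 l IH] b c; first exact: optimal_ex1.
have sys := level_system l.
have [A [B [AB v eAB rows]]] := opt_uniform b2 sys c.
have {}v := elimT (validP b2 sys A B) v.
have [N' oN' sN'] := IH b2 B; have [I iI] := initial_ex (size l).+1 A.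
pose N := [seq b :: w | w <- N'] ++ [seq shift_head b.+1 w | w <- I].
have memN w : w \in N -> (exists2 w', w' \in N' & w = b :: w') \/
    exists x w', (x :: w') \in I /\ w = (b.+1 + x) :: w'.
  rewrite mem_cat => /orP[/mapP[w' w'N ->]|/mapP[w' w'I ->]]; first by left; exists w'.
  right; have [s _] := ini_sub iI w'I; case: w' s w'I => // x w' _ xwI.
  by exists x, w'.
have memN1 w : w \in N' -> b :: w \in N.
  by move=> wN; rewrite mem_cat; apply/orP; left; apply/mapP; exists w.
have memN2 x w : x :: w \in I -> (b.+1 + x) :: w \in N.
  by move=> wI; rewrite mem_cat; apply/orP; right; apply/mapP; exists (x :: w).
have headE w : size w = (size l).+2 -> ~~ slt w [:: b, b2 & l] ->
    (exists w', [/\ w = b :: w', size w' = (size l).+1 & ~~ slt w' (b2 :: l)]) \/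
    (exists x w', w = (b.+1 + x) :: w' /\ size (x :: w') = (size l).+2).
  case: w => // y w [sw]; rewrite [slt _ _]/= negb_or -leqNgt => /andP[by_ h].
  have [ey|ny] := eqVneq y b; first by left; exists w; move: h; rewrite ey eqxx.
  by right; exists (y - b.+1), w; split; [congr (_ :: _); lia | rewrite /= sw].
(* The monomial [(b.+1 + x) :: w'] has the degree of [b :: w] when [sumn w] is [x + sumn w' + 1],
   whence the bound [.+2]. *)
have touch x w' w : x :: w' \in I -> size w = (size l).+1 -> ~~ slt w (b2 :: l) ->
    sumn w < (x + sumn w').+2 -> w \in N'.
  move=> xI sw hw lt; have [_ h] := ini_sub iI xI; apply: (opt_rows oN' _ sw hw lt).
  by rewrite sN'; apply: v.
have sN : size N = c by rewrite size_cat !size_map sN' (ini_size iI); lia.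
exists N => //; split.
- rewrite cat_uniq map_inj_uniq ?(opt_uniq oN'); last by move=> x y [].
  rewrite map_inj_in_uniq ?(ini_uniq iI) ?andbT.
    apply/hasPn => w /mapP[w' _ ->]; apply/negP => /mapP[w2 _ []]; lia.
  move=> x y /(ini_sub iI)[sx _] /(ini_sub iI)[sy _]; case: x y sx sy => [|x u] [|y w] //= _ _ [].
  by move=> /addnI -> ->.
- move=> w /memN[[w' w'N ->]|[x [w' [xI ->]]]].
    have [sw hw] := opt_sub oN' w'N; split; first by rewrite /= sw.
    by rewrite [slt _ _]/= ltnn eqxx.
  have [[sw] _] := ini_sub iI xI; split; first by rewrite /= sw.
  by rewrite [slt _ _]/= negb_or negb_and; apply/andP; split; [|apply/orP; left]; lia.
- move=> u w uN sw hw; case: (headE w sw hw) => [[w' [-> sw' hw']]|[y [w' [-> sw']]]].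
    case: (memN u uN) => [[u' u'N ->]|[x [u' [xI ->]]]] e.
      rewrite [slt _ _]/= ltnn eqxx /= => lt; apply: memN1.
      by apply: (opt_low oN' u'N sw' hw' _ lt); move: e => /=; lia.
    by move=> _; apply: memN1; apply: (touch _ _ _ xI sw' hw'); move: e => /=; lia.
  case: (memN u uN) => [[u' u'N ->]|[x [u' [xI ->]]]] e.
    by rewrite [slt _ _]/= => /orP[|/andP[/eqP]]; lia.
  rewrite [slt _ _]/= ltn_add2l eqn_add2l => lt; apply: memN2.
  by apply: (ini_low iI xI sw'); right; split=> //; move: e => /=; lia.
- move=> u w uN sw hw; case: (headE w sw hw) => [[w' [-> sw' hw']]|[y [w' [-> sw']]]].
    case: (memN u uN) => [[u' u'N ->]|[x [u' [xI ->]]]] /= /andP[h1 h2].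
      by apply: memN1; exact: (opt_div oN' u'N sw' hw' h2).
    by apply: memN1; apply: (touch _ _ _ xI sw' hw'); have := all2_leq_sumn h2; lia.
  case: (memN u uN) => [[u' u'N ->]|[x [u' [xI ->]]]] /= /andP[h1 h2]; first lia.
  apply: memN2; have h : all2 leq (y :: w') (x :: u') by rewrite /= h2 andbT; lia.
  have [e|ne] := eqVneq (sumn (y :: w')) (sumn (x :: u')).
    by rewrite (all2_leq_eq h e).
  apply: (ini_low iI xI sw'); left; have := all2_leq_sumn h; lia.
- move=> q w; rewrite sN cum_shift_row => /rows[qA qB] sw hw wq.
  case: (headE w sw hw) wq => [[w' [-> sw' hw']]|[y [w' [-> sw']]]] /= wq.
    apply: memN1; apply: (opt_rows oN' (q := q - b)) => //; first by rewrite sN'.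
    lia.
  apply: memN2; apply: (ini_full iI qA) => //=; lia.
- move=> k; rewrite sN /= eAB count_cat !count_map addnC; congr (_ + _).
    rewrite -(ini_count iI k); apply: eq_in_count => w /(ini_sub iI)[].
    by case: w.
  case: k => [|k]; last by rewrite [RHS]/= -sN' -(opt_count oN' k); apply: eq_count.
  (* Only the monomial 1 counts here; by [opt_rows] it is in [N'] as soon as it lies in the upper
     set and [N'] is nonempty. *)
  have -> : count (preim (cons b) (low 0)) N' = count_mem (nseq (size l).+1 0) N'.
    apply: eq_in_count => w /(opt_sub oN')[sw _]; rewrite [LHS]/(all (pred1 0) (drop 0 w)) drop0 -sw.
    exact: (sameP (all_pred1P 0 w) eqP).
  rewrite count_uniq_mem ?(opt_uniq oN') //.
  have eu : shift_row b2 (urow l) 0 = ~~ slt (nseq (size l).+1 0) (b2 :: l).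
    rewrite -count_up; have : mons (size l) 0 = [:: nseq (size l).+1 0].
      have := size_mons (size l) 0; rewrite (sys_size0 (level_nseq _)).
      case E : (mons (size l) 0) => [|z [|]] // _; have := mem_mons (size l) 0 (nseq (size l).+1 0).
      by rewrite E /is_mon size_nseq sumn_nseq mul0n !eqxx inE => /eqP <-.
    by move=> -> /=; rewrite addn0.
  rewrite [RHS]/= eu; have [hz|hz] := boolP (slt (nseq (size l).+1 0) (b2 :: l)).
    suff /negbTE -> : nseq (size l).+1 0 \notin N' by rewrite min0n.
    by apply/negP => /(opt_sub oN')[_]; rewrite hz.
  have [B0|B0] := posnP B.
    by rewrite B0; move: sN'; rewrite B0 => /size0nil ->.
  rewrite (opt_rows oN' (q := 1)) ?size_nseq ?sumn_nseq ?mul0n //; first by lia.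
  by rewrite sN' cumS cum0 eu hz.
Qed.

(** * Universal lex ideals and ladder sets *)

Lemma nat_least (P : nat -> Prop) : (exists n, P n) ->
  exists2 n, P n & forall k, P k -> n <= k.
Proof.
case=> n; elim/ltn_ind: n => n IH Pn.
case: (classic (exists2 k, k < n & P k)) => [[k kn Pk]|h]; first exact: IH Pk.
exists n => // k Pk; rewrite leqNgt; apply/negP => kn; apply: h; by exists k.
Qed.

(** Lists of a fixed length are well-ordered: the entries are minimized one after the other. *)
Lemma slt_least n (P : seq nat -> Prop) : (exists2 s, size s = n & P s) ->
  exists s, [/\ size s = n, P s & forall t, size t = n -> P t -> ~~ slt t s].
Proof.
elim: n P => [|n IH] P [s ss Ps]; first by exists s; case: s ss Ps => // _ P0; split=> // -[].
case: s ss Ps => // x0 s0 [ss] Ps.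
have [|x [s1 ss1 Ps1] xmin] := @nat_least (fun x => exists2 s, size s = n & P (x :: s)).
  by exists x0, s0.
have [|s [s2 Ps2 smin]] := IH (fun s => P (x :: s)); first by exists s1.
exists (x :: s); split=> //=; first by rewrite s2.
case=> // y t [st] Pt; rewrite /= negb_or -leqNgt (xmin y) /=; last by exists t.
by rewrite negb_and; case: eqP Pt => //= -> /(smin t st).
Qed.

Lemma slt_nthP s t : size s = size t ->
  slt s t <-> exists i, [/\ i < size s, forall j, j < i -> nth 0 s j = nth 0 t j
    & nth 0 s i < nth 0 t i].
Proof.
elim: s t => [|x s IH] [|y t] //=; first by split=> // -[i []].
case=> /IH{}IH; split.
  case/orP=> [xy|/andP[/eqP exy /IH[i [si h lt]]]]; first by exists 0.
  by exists i.+1; split=> // -[|j] //= ji; apply: h.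
case=> [[|i] [si h lt]] /=; first by rewrite [x < y]lt.
have /= -> := h 0 isT; rewrite eqxx; apply/orP; right; apply/IH.
by exists i; split=> // j ji; apply: (h j.+1).
Qed.

Lemma slt_seqlexi (s t : seq nat) : size s = size t ->
  ((s : seqlexi nat) < (t : seqlexi nat))%O = slt s t.
Proof.
elim: s t => [|x s IH] [|y t] //= [st]; rewrite Order.SeqLexiOrder.Exports.ltxi_cons.
by rewrite !leEnat (IH t st); case: ltngtP.
Qed.

Lemma all2_leqP (s t : seq nat) : size s = size t ->
  (forall i, i < size s -> nth 0 s i <= nth 0 t i) -> all2 leq s t.
Proof.
elim: s t => [|x s IH] [|y t] //= [st] h.
by rewrite (h 0) //= IH // => i si; apply: (h i.+1).
Qed.

(** * Exponent vectors as lists *)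

Section Multinom.
Variable n : nat.
Implicit Types u v w : 'X_{1..n}.

Definition mseq u : seq nat := tval (multinom_val u).
Definition seqm (s : seq nat) : 'X_{1..n} := [multinom nth 0 s i | i < n].

Lemma size_mseq u : size (mseq u) = n. Proof. exact: size_tuple. Qed.

Lemma nth_mseq u (i : 'I_n) : nth 0 (mseq u) i = u i.
Proof. by rewrite /mseq /fun_of_multinom (tnth_nth 0). Qed.

Lemma mseqK : cancel mseq seqm.
Proof. by move=> u; apply/mnmP => i; rewrite mnmE nth_mseq. Qed.

Lemma seqmK s : size s = n -> mseq (seqm s) = s.
Proof.
move=> ss; apply: (@eq_from_nth _ 0); first by rewrite size_mseq.
by move=> i; rewrite size_mseq => i_n; rewrite (nth_mseq _ (Ordinal i_n)) mnmE.
Qed.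

Lemma mdeg_mseq u : mdeg u = sumn (mseq u).
Proof.
rewrite mdegE sumnE (big_nth 0) size_mseq big_mkord.
by apply: eq_bigr => i _; rewrite nth_mseq.
Qed.

Lemma mlex_mseq u v : mlex_lt u v = slt (mseq u) (mseq v).
Proof. by apply: slt_seqlexi; rewrite !size_mseq. Qed.

Lemma mlexP u v : mlex_lt u v <->
  exists i : 'I_n, (forall j : 'I_n, j < i -> u j = v j) /\ u i < v i.
Proof.
rewrite mlex_mseq slt_nthP ?size_mseq //; split=> [[i [i_n h lt]]|[i [h lt]]].
  exists (Ordinal i_n); rewrite -!nth_mseq; split=> // j ji.
  by rewrite -!nth_mseq; apply: h.
exists i; rewrite !nth_mseq; split=> // j ji.
have jn : j < n by apply: ltn_trans ji (ltn_ord i).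
by rewrite !(nth_mseq _ (Ordinal jn)); apply: h.
Qed.

Lemma mlex_total u v : ~~ mlex_lt u v -> ~~ mlex_lt v u -> u = v.
Proof.
rewrite !mlex_mseq => uv vu; apply: (can_inj mseqK).
by apply: slt_total; rewrite ?size_mseq.
Qed.

Lemma mlex_trans u v w : mlex_lt u v -> mlex_lt v w -> mlex_lt u w.
Proof. by rewrite !mlex_mseq; apply: slt_trans. Qed.

Lemma mlex_irr u : mlex_lt u u = false.
Proof. by rewrite mlex_mseq slt_irr. Qed.

Lemma mlex_lem u v : (u <= v)%MM -> ~~ mlex_lt v u.
Proof. by move/mnm_lepP=> uv; apply/negP => /mlexP[i [_]]; have := uv i; lia. Qed.

Lemma mlex_add2l w u v : mlex_lt (w + u)%MM (w + v)%MM -> mlex_lt u v.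
Proof.
move/mlexP=> [i [h lt]]; apply/mlexP; exists i; split; last first.
  by move: lt; rewrite !mnmDE ltn_add2l.
by move=> j ji; have := h j ji; rewrite !mnmDE => /addnI.
Qed.

Lemma all2_lem u v : (u <= v)%MM -> all2 leq (mseq u) (mseq v).
Proof.
move/mnm_lepP=> uv; apply: all2_leqP; rewrite !size_mseq // => i i_n.
by rewrite !(nth_mseq _ (Ordinal i_n)).
Qed.

Lemma max_var_low k u : (max_var u <= k.+1) = low k (mseq u).
Proof.
rewrite /max_var geq_max /=; apply/bigmax_leqP/(all_nthP 0) => [h i|h i ui].
  rewrite size_drop size_mseq nth_drop => hi.
  have i_n : k.+1 + i < n by lia.
  rewrite (nth_mseq _ (Ordinal i_n)) /=; apply/negPn/negP => /h /=; lia.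
rewrite leqNgt; apply/negP => hi; have := h (i - k.+1).
rewrite size_drop size_mseq nth_drop subnKC // nth_mseq /= (negbTE ui).
by move=> /(_ _); have := ltn_ord i; lia.
Qed.

Lemma m_le_count k (M : {fset 'X_{1..n}}) :
  m_le k.+1 M = count (low k) [seq mseq u | u <- enum_fset M].
Proof.
rewrite count_map -size_filter; apply: perm_size; apply: uniq_perm.
- exact: fset_uniq.
- exact: filter_uniq (fset_uniq _).
by move=> u; rewrite mem_filter /= -max_var_low !inE andbC.
Qed.

End Multinom.

(** * Monomial ideals and their extensions *)

Section MonomialIdeals.
Variables (K : fieldType) (n : nat).
Implicit Types (I G : {mpoly K[n]} -> Prop) (A B : 'X_{1..n} -> Prop).
Implicit Types u v m : 'X_{1..n}.

Lemma ideal_genP G : is_ideal (ideal_gen G).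
Proof.
split=> [|p q Ip Iq|r p Ip] J iJ GJ; first by have [J0 _ _] := iJ.
  by have [_ JD _] := iJ; apply: JD; [apply: Ip | apply: Iq].
by have [_ _ JM] := iJ; apply: JM; apply: Ip.
Qed.

Lemma ideal_sum (T : eqType) (s : seq T) (F : T -> {mpoly K[n]}) I : is_ideal I ->
  (forall x, x \in s -> I (F x)) -> I (\sum_(x <- s) F x)%R.
Proof. by case=> I0 ID _ h; rewrite big_seq; elim/big_ind: _. Qed.

Lemma ideal_scale c p I : is_ideal I -> I p -> I (c *: p)%R.
Proof. by case=> _ _ IM Ip; rewrite -mul_mpolyC; apply: IM. Qed.

Lemma supp_ideal B : (forall u v, B u -> B (u + v)%MM) ->
  is_ideal (fun p : {mpoly K[n]} => forall m, m \in msupp p -> B m).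
Proof.
move=> BD; split=> [m|p q Bp Bq m|r p Bp m]; first by rewrite msupp0.
  by move/msuppD_le; rewrite mem_cat => /orP[/Bp|/Bq].
by move/msuppM_le/allpairsP=> [[u v] /= [_ /Bp Bv ->]]; rewrite addmC; apply: BD.
Qed.

Lemma ideal_gen_monP A (p : {mpoly K[n]}) :
  ideal_gen_mon A p <-> forall m, m \in msupp p -> exists2 a, A a & (a <= m)%MM.
Proof.
split=> [Ip|Ap].
  apply: (Ip (fun q => forall m, m \in msupp q -> exists2 a, A a & (a <= m)%MM)).
    apply: (supp_ideal (B := fun m => exists2 a, A a & (a <= m)%MM)) => u v [a Aa au].
    by exists a => //; apply: lepm_trans au (lem_addr _ _).
  by move=> g [a Aa ->] m; rewrite msuppX inE => /eqP ->; exists a => //; exact: lepm_refl.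
have iA := @ideal_genP (fun g => exists2 m, A m & g = 'X_[m]).
rewrite [p]mpolyE; apply: ideal_sum => // m /Ap[a Aa am]; apply: (ideal_scale _ iA).
have [_ _ AM] := iA; rewrite -(submK am) mpolyXD; apply: AM => J _ AJ.
by apply: AJ; exists a.
Qed.

Lemma ideal_gen_monX A m : ideal_gen_mon A ('X_[m] : {mpoly K[n]}) <->
  exists2 a, A a & (a <= m)%MM.
Proof.
rewrite ideal_gen_monP msuppX; split=> [h|h m']; first by apply: h; rewrite inE.
by rewrite inE => /eqP ->.
Qed.

Lemma monomial_idealP I : monomial_ideal I ->
  forall p, I p <-> forall m, m \in msupp p -> I 'X_[m].
Proof.
move=> [A IA] p; rewrite IA ideal_gen_monP.
by split=> h m /h; rewrite IA ideal_gen_monX.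
Qed.

Lemma monomial_ideal_up I u v : monomial_ideal I -> (u <= v)%MM -> I 'X_[u] -> I 'X_[v].
Proof.
move=> [A IA] uv; rewrite !IA !ideal_gen_monX => -[a Aa au].
by exists a => //; apply: lepm_trans uv.
Qed.

End MonomialIdeals.

Definition mtrunc n (w : 'X_{1..n.+1}) : 'X_{1..n} :=
  [multinom w (widen_ord (leqnSn n) i) | i < n].

Lemma mnmwidenK n : cancel (@mnmwiden n) (@mtrunc n).
Proof. by move=> u; apply/mnmP => i; rewrite mnmE mnmwiden_widen. Qed.

Lemma mnmwiden_trunc n (w : 'X_{1..n.+1}) : (mnmwiden (mtrunc w) <= w)%MM.
Proof.
apply/mnm_lepP => i; case: (unliftP ord_max i) => [j ->|->]; last by rewrite mnmwiden_ordmax.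
have -> : lift ord_max j = widen_ord (leqnSn n) j.
  by apply/val_inj; rewrite /= /bump leqNgt ltn_ord.
by rewrite mnmwiden_widen mnmE.
Qed.

Lemma extend_idealX (K : fieldType) n (I : {mpoly K[n]} -> Prop) w : monomial_ideal I ->
  extend_ideal I 'X_[w] <-> I 'X_[mtrunc w].
Proof.
move=> mI; split=> [Iw|Iw J [_ _ JM] IJ]; last first.
  rewrite -(submK (mnmwiden_trunc w)) mpolyXD; apply: JM; apply: IJ.
  by exists 'X_[mtrunc w]; rewrite ?mwidenX.
pose J (g : {mpoly K[n.+1]}) := forall m, m \in msupp g -> I 'X_[mtrunc m].
have iJ : is_ideal J.
  apply: (@supp_ideal K n.+1 (fun m => I 'X_[mtrunc m])) => u v; apply: monomial_ideal_up => //.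
  by apply/mnm_lepP => i; rewrite !mnmE leq_addr.
apply: (Iw J iJ); last by rewrite msuppX inE.
move=> g [p /(monomial_idealP mI) Ip ->].
rewrite [p]mpolyE GRing.raddf_sum; apply: ideal_sum => // m mp /=.
rewrite mwidenZ mwidenX; apply: (ideal_scale _ iJ) => m'.
by rewrite msuppX inE => /eqP ->; rewrite mnmwidenK; apply: Ip.
Qed.

Lemma slt_rcons s t x y : slt s t -> slt (rcons s x) (rcons t y).
Proof.
elim: s t => [|a s IH] [|b t] //= /orP[->//|/andP[-> /IH ->]]; exact: orbT.
Qed.

(* [u] and [v] become of equal degree after multiplication by powers of the new variable. *)
Lemma universal_lex_up (K : fieldType) n (I : {mpoly K[n]} -> Prop) u v :
  universal_lex_ideal I -> mlex_lt u v -> I 'X_[u] -> I 'X_[v].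
Proof.
case=> -[mI _] [_ lexI] uv.
have truncK (w : 'X_{1..n}) k : mtrunc [multinom of rcons w k] = w.
  by apply/mnmP => i; rewrite mnmE multinomE (tnth_nth 0) /= nth_rcons size_mseq ltn_ord nth_mseq.
move=> Iu; rewrite -(truncK v (mdeg u)) -extend_idealX //.
apply: (lexI [multinom of rcons u (mdeg v)]); first by rewrite extend_idealX // truncK.
  by rewrite !(mdeg_mseq [multinom of _]) /mseq /= !sumn_rcons -!mdeg_mseq addnC.
by rewrite mlex_mseq; apply: slt_rcons; rewrite -mlex_mseq.
Qed.

Lemma universal_lex_min (K : fieldType) n (I : {mpoly K[n]} -> Prop) :
  universal_lex_ideal I -> nonzero_ideal I ->
  exists u, forall v, I 'X_[v] <-> ~~ mlex_lt v u.
Proof.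
move=> uI [p Ip p0]; have [[mI _] _] := uI.
have [w Iw] : exists w, I 'X_[w].
  exists (mlead p); apply: (iffLR (monomial_idealP mI p)) => //; exact: mlead_supp.
have [|s [ss Is smin]] := @slt_least n (fun s => I 'X_[seqm n s]).
  by exists (mseq w); [apply: size_mseq | rewrite mseqK].
exists (seqm n s) => v; split=> [Iv|].
  by rewrite mlex_mseq seqmK //; apply: smin; rewrite ?size_mseq ?mseqK.
have [lt _|nlt nlt'] := boolP (mlex_lt (seqm n s) v); first exact: universal_lex_up lt Is.
by rewrite -(mlex_total nlt nlt').
Qed.

(** * Ladder sets as lower lex segments *)

Section Rows.
Variable n : nat.
Implicit Types (u v w : 'X_{1..n}) (t : nat) (a : 'I_n -> int) (i j k : 'I_n).

Lemma deltaE a i j : delta a i j =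
  if j < i then `|a j|%N else if j == i then `|(a j + 1)%R|%N else 0.
Proof. by rewrite mnmE. Qed.

Lemma delta_up (u0 : 'X_{1..n}) : 0 < n -> exists t a, admissible t a /\
  forall v, ~~ mlex_lt v u0 <-> exists2 i : 'I_n, i < t & (delta a i <= v)%MM.
Proof.
move=> n_gt0; have [u00|] := eqVneq u0 0%MM.
  exists 1, (fun=> -1)%R; split; first by split; [lia | right].
  move=> v; split=> _.
    exists (Ordinal n_gt0) => //; apply/mnm_lepP => j; rewrite deltaE /=.
    by case: ifP.
  by rewrite u00; apply: mlex_lem; apply/mnm_lepP => j; rewrite mnm0E.
move=> u00; have [i0 ui0] : exists i, u0 i != 0.
  by apply/existsP; apply: contraNT u00 => /existsPn h; apply/eqP/mnmP => i; rewrite mnm0E; apply/eqP/negPn/h.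
have [p up pmax] := @arg_maxnP _ i0 (fun i => u0 i != 0) (fun i => i : nat) ui0.
pose a j : int := if j == p then ((u0 p).-1 : int) else u0 j.
have da i j : i <= p -> delta a i j =
    if j < i then u0 j else if j == i then (if i == p then u0 p else (u0 i).+1) else 0.
  move=> ip; rewrite deltaE /a.
  case: ltnP => ji; first by rewrite ifF //; apply/negbTE; rewrite -val_eqE /=; lia.
  by case: eqP => // ->; case: eqP => _; lia.
exists p.+1, a; split.
  by split; [have := ltn_ord p; lia | left => i _; rewrite /a; case: ifP].
move=> v; split.
  move=> nlt; have [/mlexP [i [h lt]]|nlt'] := boolP (mlex_lt u0 v); last first.
    exists p => //; rewrite (mlex_total nlt nlt'); apply/mnm_lepP => j.
    by rewrite da //; case: ltnP => // _; case: eqP => [->|] //; rewrite eqxx.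
  have [ip|pi] := leqP i p.
    exists i => //; apply/mnm_lepP => j; rewrite da //; case: ltnP => [/h ->//|_].
    by case: eqP => // ->; case: eqP lt => [->|] //; lia.
  exists p => //; apply/mnm_lepP => j; rewrite da //; case: ltnP => [jp|_].
    by rewrite h //; lia.
  by case: eqP => // ->; rewrite eqxx h.
case=> i; rewrite ltnS => ip /mnm_lepP le; apply/negP => /mlexP [k [h lt]].
have kp : k <= p by apply: pmax; lia.
have := le k; rewrite da //; case: (ltngtP k i) => [ki|ik|/val_inj ki]; first lia.
  move=> _; have := le i; rewrite da // ltnn eqxx (h _ ik) ifF; first lia.
  by apply/negbTE; rewrite -val_eqE /=; lia.
by subst k; rewrite eqxx; case: eqP lt => [<-|_]; lia.
Qed.

Definition in_row a i v := (forall j, j < i -> v j = `|a j|%N) /\ (delta a i <= v)%MM.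

Lemma in_rowP a i v : in_row a i v ->
  (v - delta a i)%MM \in mon_from i /\ (delta a i + (v - delta a i) = v)%MM.
Proof.
case=> h le; split; last by rewrite addmC submK.
by apply/forallP => j; apply/implyP => ji; rewrite mnmBE h // deltaE ji subnn.
Qed.

Lemma in_row_ex t a i v : admissible t a -> i < t -> (delta a i <= v)%MM ->
  exists2 j : 'I_n, j < t & in_row a j v.
Proof.
case=> t1 adm; have [k] := ubnP (i : nat); elim: k i => // k IH i ik it le.
case: (classic (exists2 j : 'I_n, j < i & `|a j|%N < v j)) => [[j ji lt]|h].
  have a0 : forall l : 'I_n, l < t -> (0 <= a l)%R by case: adm => // -[]; lia.
  apply: (IH j); [lia | lia |]; apply/mnm_lepP => l; rewrite deltaE.
  have := elimT mnm_lepP le l; rewrite deltaE; case: ltnP => li; case: ltnP => lj //; try lia.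
    by case: eqP => // -> _; have := a0 j ltac:(lia); lia.
  by have -> : (l == j) = false by rewrite -val_eqE /=; lia.
exists i => //; split=> // j ji; apply/eqP; rewrite eqn_leq.
have := elimT mnm_lepP le j; rewrite deltaE ji => ->; rewrite andbT leqNgt.
by apply/negP => lt; apply: h; exists j.
Qed.

(** For [u] in row [i] and [v] in row [j], the case [i = j] is the rev-lex property and [j < i]
    would make [v] larger. For [i < j] condition (ii) is applied along [i], ..., [j], which requires
    in each intermediate row a monomial of the given degree. *)
Lemma ladder_low (K : fieldType) (U : {mpoly K[n]} -> Prop) t a M u v :
  ulex_form U t a -> ladder_conditions t a M ->
  u \in M -> U 'X_[u] -> U 'X_[v] -> mdeg v = mdeg u -> mlex_lt v u -> v \in M.
Proof.
case=> adm eU [rowM stepM] uM.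
have row x : U 'X_[x] -> exists2 i : 'I_n, i < t & in_row a i x.
  rewrite eU ideal_gen_monX => -[_ [i it ->] le]; exact: in_row_ex le.
case/row=> i it iu /row[j jt jv] dvu vu.
have [wu eu] := in_rowP iu; have [wv ev] := in_rowP jv.
have inM k x : in_row a k x -> x \in M = ((x - delta a k)%MM \in section_of a M k).
  by case/in_rowP=> wx ex; rewrite inE wx ex.
case: (ltngtP i j) => [ij|ji|/val_inj eij]; last first.
- subst j; rewrite (inM i) //.
  apply: (proj1 (rowM i it)) (u - delta a i)%MM _ _ wv _ _.
  + by rewrite -inM.
  + by apply: (@addnI (mdeg (delta a i))); rewrite -!mdegD ev eu.
  + by apply: (mlex_add2l (w := delta a i)); rewrite ev eu.
- have a0 : (0 <= a j)%R by case: adm => t1 [h|[t10 _]]; [exact: h | lia].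
  suff lt : mlex_lt u v by have := mlex_trans lt vu; rewrite mlex_irr.
  apply/mlexP; exists j; split=> [k kj|].
    by rewrite (proj1 iu) ?(proj1 jv) //; apply: ltn_trans ji.
  rewrite (proj1 iu) //; have := elimT mnm_lepP (proj2 jv) j.
  by rewrite deltaE ltnn eqxx; lia.
have a0 (k : 'I_n) : k < t -> (0 <= a k)%R.
  by case: adm => t1 [h|[t10 _]]; [exact: h | lia].
have vj := elimT mnm_lepP (proj2 jv) j.
rewrite deltaE ltnn eqxx in vj; have aj := a0 j jt.
suff H (d : nat) (k : 'I_n) x : k = (i + d).+1 :> nat -> k <= j -> in_row a k x ->
    mdeg x = mdeg u -> x \in M.
  by apply: (H (j - i.+1) j) => //; lia.
elim: d k x => [|d IH] k x ek kj kx dx.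
  rewrite (inM k) //; have [wx ex] := in_rowP kx.
  apply: (stepM i k (mdeg u)) => //; rewrite ?ex //; try lia.
  by exists (u - delta a i)%MM; rewrite ?eu // -inM.
have k'n : (i + d).+1 < n by have := ltn_ord k; lia.
pose k' := Ordinal k'n; have [wx ex] := in_rowP kx.
rewrite (inM k) //; apply: (stepM k' k (mdeg u)) => //; rewrite ?ex //=; try lia.
have vU : (U_(j) <= v)%MM.
  by apply/mnm_lepP => l; rewrite mnm1E; case: eqP => // <-; lia.
(* Replacing one factor x_j of [v] by x_k' keeps the degree and gives a monomial of row [k']. *)
pose y := (v - U_(j) + U_(k'))%MM.
have k'y : in_row a k' y.
  split=> [l lk|]; first rewrite mnmDE mnmBE !mnm1E.
    rewrite (proj1 jv) /=; last by move: lk => /=; lia.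
    by rewrite -!val_eqE /= !gtn_eqF ?subn0 ?addn0 //; move: lk => /=; lia.
  apply/mnm_lepP => l; rewrite mnmDE mnmBE !mnm1E deltaE -!val_eqE /=.
  case: ltnP => lk.
    rewrite (proj1 jv); last by lia.
    by rewrite !gtn_eqF ?subn0 ?addn0 //; lia.
  case: eqP => // lk'; have {lk'}-> : l = k' by apply/val_inj.
  rewrite (proj1 jv) /=; last by lia.
  by have := a0 k' ltac:(rewrite /=; lia); rewrite eqxx gtn_eqF; lia.
have dy : mdeg y = mdeg u.
  by rewrite -dvu -[in RHS](submK vU) !mdegD !mdeg1.
have [wy ey] := in_rowP k'y.
exists (y - delta a k')%MM; last by rewrite ey.
by rewrite -inM //; apply: (IH k') => //=; lia.
Qed.

Lemma mlex_addl w u v : mlex_lt u v -> mlex_lt (w + u)%MM (w + v)%MM.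
Proof.
move/mlexP=> [i [h lt]]; apply/mlexP; exists i; split; last by rewrite !mnmDE ltn_add2l.
by move=> j ji; rewrite !mnmDE h.
Qed.

(** Condition (ii) follows from the lex condition because, in equal degree, row [i.+1] lies below
    row [i]: the two agree before [i], and the exponent at [i] is smaller in row [i.+1]. *)
Lemma low_ladder (K : fieldType) (U : {mpoly K[n]} -> Prop) t a (M : {pred 'X_{1..n}}) :
  ulex_form U t a -> 
  (forall u v, u \in M -> U 'X_[v] -> mdeg v = mdeg u -> mlex_lt v u -> v \in M) ->
  (forall u v, u \in M -> U 'X_[v] -> (v <= u)%MM -> v \in M) ->
  ladder_conditions t a M.
Proof.
case=> adm eU low div.
have inU i w : i < t -> U 'X_[delta a i + w].
  move=> it; rewrite eU ideal_gen_monX; exists (delta a i); last exact: lem_addr.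
  by exists i.
split=> [i it|i j d eij jt [w wi <-] w' wj dw].
  split=> [u v /andP[ui uM] vi dv vu|u v /andP[/forallP ui uM] vu].
    rewrite inE vi /=; apply: low uM (inU i v it) _ (mlex_addl _ vu).
    by rewrite !mdegD dv.
  apply/andP; split; last first.
    by apply: div uM (inU i v it) _; apply/mnm_lepP => j; rewrite !mnmDE leq_add2l; apply: mnm_lepP.
  apply/forallP => j; apply/implyP => ji; have /implyP/(_ ji) := ui j.
  by have := elimT mnm_lepP vu j; rewrite /=; lia.
case/andP: wi => /forallP wi wM; rewrite inE wj /=.
apply: low wM (inU j w' jt) dw _; apply/mlexP; exists i.
have wj0 (k : 'I_n) : k < j -> w' k = 0.
  by move=> kj; have /forallP/(_ k)/implyP/(_ kj)/eqP := wj.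
split=> [k ki|].
  have /implyP/(_ ki)/eqP wk := wi k.
  by rewrite !mnmDE !deltaE ki wk wj0 ?ifT //; lia.
rewrite !mnmDE !deltaE ltnn eqxx wj0 ?ifT; [|lia|lia].
have : (0 <= a i)%R by case: adm => t1 [h|[t10 _]]; [apply: h; lia | lia].
by lia.
Qed.
End Rows.

Theorem proposition3p9 (K : fieldType) (n : nat) (hn : (0 < n)%N)
    (U : {mpoly K[n]} -> Prop)
    (hU : universal_lex_ideal U) (hU0 : nonzero_ideal U) (c : nat) :
  exists N : {fset 'X_{1..n}},
    [/\ ladder_set U (mem N), #|` N|%fset = c &
        forall M : {fset 'X_{1..n}},
          ladder_set U (mem M) -> #|` M|%fset = c ->
          vec_succeq (m_vec N) (m_vec M)].
Proof.
have [u0 eU] := universal_lex_min hU hU0.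
have [t [a [adm eu0]]] := delta_up u0 hn.
have [[mU _] _] := hU.
have form : ulex_form U t a.
  split=> // p; rewrite (monomial_idealP mU) ideal_gen_monP.
  split=> h m /h; last by case=> _ [i it ->] le; apply/eU/eu0; exists i.
  by case/eU/eu0=> i it le; exists (delta a i) => //; exists i.
have [b [l [ebl en]]] : exists b l, mseq u0 = b :: l /\ n = (size l).+1.
  by have := size_mseq u0; case: (mseq u0) => [|b l] /= e; [lia | exists b, l].
have eU' v : U 'X_[v] <-> ~~ slt (mseq v) (b :: l) by rewrite eU mlex_mseq ebl.
have [s os ss] := optimal_ex b l c.
have memK w : w \in s -> mseq (seqm n w) = w.
  by case/(opt_sub os)=> sw _; apply: seqmK; rewrite sw.
pose N := [fset seqm n w | w in s]%fset.
have memN v : (v \in N) = (mseq v \in s).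
  apply/imfsetP/idP => [[w /= ws ->]|vs]; first by rewrite memK.
  by exists (mseq v); rewrite ?mseqK.
have permN : perm_eq [seq mseq u | u <- enum_fset N] s.
  apply: uniq_perm; first by rewrite (map_inj_uniq (can_inj (@mseqK n))) fset_uniq.
    exact: opt_uniq os.
  move=> w; apply/mapP/idP => [[v + ->]|ws]; first by rewrite -memN.
  by exists (seqm n w); rewrite ?memK // memN memK.
have size_n v : size (mseq v) = (size l).+1 := etrans (size_mseq v) en.
have cardM (M : {fset 'X_{1..n}}) : size [seq mseq u | u <- enum_fset M] = #|` M|%fset.
  by rewrite size_map.
exists N; split; first split.
- by move=> u; rewrite [u \in _]memN => /(opt_sub os)[_ ?]; apply/eU'.
- exists t, a; split=> //; apply: (low_ladder form) => u v.
    rewrite ![_ \in _]memN => us /eU' Uv; rewrite !mdeg_mseq mlex_mseq.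
    exact: (opt_low os us (size_n v) Uv).
  rewrite ![_ \in _]memN => us /eU' Uv /all2_lem.
  exact: (opt_div os us (size_n v) Uv).
- by rewrite -ss -(perm_size permN) cardM.
(* The data [t'], [a'] of [M] need not be literally [t], [a]; [ladder_low] turns them into a
   property of [M] and [U] alone. *)
move=> M [subM [t' [a' [form' condM]]]] cM i.
rewrite /m_vec !m_le_count (permP permN) (opt_count os) ss -cM -cardM.
apply: ladder_bound.
- by rewrite (map_inj_uniq (can_inj (@mseqK n))) fset_uniq.
- by move=> _ /mapP[v vM ->]; split=> //; apply/eU'/subM.
move=> _ v /mapP[u uM ->] sv Uv dv vu.
have ev : mseq (seqm n v) = v by apply: seqmK; rewrite sv.
apply/mapP; exists (seqm n v) => //.
apply: (ladder_low form' condM uM (subM _ uM)).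
- by apply/eU'; rewrite ev.
- by rewrite !mdeg_mseq ev.
- by rewrite mlex_mseq ev.
Qed.
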